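(* Let $H$ be a connected graph. There is $k \in \mathbb{N}$ such that $K_k \square K_k$ is $H$-induced-saturated if and only if $H$ is chipped or $H \in \mathcal{A} \cap \mathcal{B}$.
   Context: All graphs are finite and simple; $\mathbb{N}=\{1,2,\dots\}$. For graphs $H,G$, write $H \subseteq_I G$ if $G$ contains an induced subgraph isomorphic to $H$. A graph $G$ is $H$-induced-saturated if $H \not\subseteq_I G$, but $H \subseteq_I G - e$ for every $e \in E(G)$ and $H \subseteq_I G + e$ for every edge $e \in E(\overline{G})$ of the complement. $K_k \square K_k$ is the graph whose vertices are all pairs with entries in a fixed $k$-element set, two pairs being adjacent iff they differ in exactly one coordinate. $\mathcal{C}(G)$ denotes the number of connected components of $G$, and $\{\{X\}\}$ the complete graph on vertex set $X$ (so $\{\{w\}\}$ is the one-vertex graph on $w$). **2-Hamming graphs.** A graph $H$ is 2-Hamming if $H \subseteq_I K_k \square K_k$ for some $k \in \mathbb{N}$. A 2-Hamming decomposition of $H$ is a pair $\{F_1,F_2\}$ of graphs with $V(F_1)=V(F_2)=V(H)$, such that $E(F_1)$ and $E(F_2)$ are disjoint with union $E(H)$, and each $F_i$ is a pairwise vertex-disjoint union of cliques (single vertices allowed); consequently a clique (component) of $F_1$ and a clique of $F_2$ intersect in at most one vertex. (A graph is 2-Hamming iff it has a 2-Hamming decomposition.) A 2-Hamming decomposition $\{F_1,F_2\}$ of a 2-Hamming graph $H$ is optimal if $\min\{k : H \subseteq_I K_k \square K_k\} = \max_{i\in\{1,2\}} \mathcal{C}(F_i)$. $H$ is balanced if $\mathcal{C}(F_1)=\mathcal{C}(F_2)$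 for an optimal 2-Hamming decomposition $\{F_1,F_2\}$ of $H$, and unbalanced otherwise. For a subgraph $H'$ of $H$ and $i \in \{1,2\}$, $F_i|H'$ denotes the subgraph of $F_i$ that is the union of those components of $F_i$ whose vertex sets are completely contained in $V(H')$. **Chipped graphs.** A graph $H$ is chipped if $H = H' - e$, where $H'$ is a connected 2-Hamming graph with a 2-Hamming decomposition $\{F_1,F_2\}$ such that $F_1$ has a component $K$ of order 3 or 4 that contains the endpoints $u,v$ of $e$, and one of the following holds: - ch1) $V(K)=\{u,v,w\}$ and $\deg_{H'}(w) \geq 3$; - ch2) $V(K)=\{u,v,w\}$ and $H' - E(K)$ has two components, one of which is $\{\{w\}\}$; - ch3) $V(K)=\{u,v,w,x\}$, $\deg_{H'}(w)=3$, and $H' - E(K)$ has a connected component $\widetilde{H}$ such that $V(K)\cap V(\widetilde{H}) = \{u\}$. **Class $\mathcal{A}$.** $\mathcal{A}$ is the class of connected, unbalanced, 2-Hamming graphs $H$ that have an optimal 2-Hamming decomposition $\{F_1,F_2\}$ with $\mathcal{C}(F_1)>\mathcal{C}(F_2)$ such that $H$ has two nonadjacent vertices $u,v$ for which one of the following holds: - a1) $\deg_{F_1}(u)=\deg_{F_1}(v)=0$; - a2) there is a vertex $w \in N(u)\cap N(v)$ such that $H - \{uw,wv\}$ has 3 components $H_1,H_2,H_3$ with $\mathcal{C}(F_1|H_1)>\mathcal{C}(F_2|H_1)$, $\mathcal{C}(F_1|H_2)>\mathcal{C}(F_2|H_2)$, and $H_3=\{\{w\}\}$. **Class $\mathcal{B}$.**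 $\mathcal{B}$ is the class of connected, unbalanced, 2-Hamming graphs $H$ that have an optimal 2-Hamming decomposition $\{F_1,F_2\}$ with $\mathcal{C}(F_1)>\mathcal{C}(F_2)$ such that $H$ has two adjacent vertices $u,v$ for which one of the following holds: - b1) the edge $e=uv$ is a bridge with $e \in E(F_i)$ (where $i\in\{1,2\}$) such that the components $H_1,H_2$ of $H-e$ satisfy $\mathcal{C}(F_1|H_1)\geq \mathcal{C}(F_2|H_1)+i$ and $\mathcal{C}(F_1|H_2)\geq \mathcal{C}(F_2|H_2)+i$; - b2) there is a vertex $w \in N(u)\cap N(v)$, i.e. $\{u,v,w\}$ induces a triangle $T$ in $H$, and $H - E(T)$ has 3 components $H_1,H_2,H_3$ with $\mathcal{C}(F_1|H_1)>\mathcal{C}(F_2|H_1)$, $\mathcal{C}(F_1|H_2)>\mathcal{C}(F_2|H_2)$, and $H_3=\{\{w\}\}$.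
   Formalization: The formal theorem asks for k ≥ 2: for k = 1 the graph K_1 □ K_1 has no edges and no non-edges, so it is vacuously H-induced-saturated for every H with at least two vertices, e.g. H = K_2, which is neither chipped nor in A. *)

(* Defs.v *)
From mathcomp Require Import all_boot.

Set Implicit Arguments.
Unset Strict Implicit.
Unset Printing Implicit Defensive.

(* A finite simple graph is an adjacency relation [e : rel T] on a finite type
   of vertices satisfying [is_graph e].  A subgraph is given by a relation on
   the same type, or, when only its vertices matter, by a set of vertices. *)

Definition is_graph (T : finType) (e : rel T) : Prop :=
  symmetric e /\ irreflexive e.

Definition edge_uv (T : finType) (u v : T) : rel T :=
  [rel x y | [set x; y] == [set u; v]].

Definition edges_in (T : finType) (e : rel T) (A : {set T}) : rel T :=
  [rel x y | [&& e x y, x \in A & y \in A]].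

Definition del_edges (T : finType) (e D : rel T) : rel T :=
  [rel x y | e x y && ~~ D x y].

Definition add_edges (T : finType) (e D : rel T) : rel T :=
  [rel x y | e x y || D x y].

Definition deg (T : finType) (e : rel T) (x : T) : nat := #|[set y | e x y]|.

Definition connected_graph (T : finType) (e : rel T) : Prop :=
  0 < #|T| /\ forall x y : T, connect e x y.

Definition components (T : finType) (e : rel T) : {set {set T}} :=
  [set [set y | connect e x y] | x : T].

Definition ncomp (T : finType) (e : rel T) : nat := #|components e|.

(* The number of components of [F|H'], where [A] is the vertex set of [H']:
   these are the components of [F] contained in [A]. *)
Definition ncomp_in (T : finType) (F : rel T) (A : {set T}) : nat :=
  #|[set C in components F | C \subset A]|.

Definition bridge (T : finType) (e : rel T) (u v : T) : Prop :=
  e u v /\ ncomp e < ncomp (del_edges e (edge_uv u v)).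

Definition induced_sub (T U : finType) (h : rel T) (g : rel U) : Prop :=
  exists f : T -> U, injective f /\ forall x y : T, h x y = g (f x) (f y).

Definition induced_saturated (T U : finType) (h : rel T) (g : rel U) : Prop :=
  [/\ ~ induced_sub h g,
      forall x y : U, g x y -> induced_sub h (del_edges g (edge_uv x y))
    & forall x y : U, x != y -> ~~ g x y ->
        induced_sub h (add_edges g (edge_uv x y))].

Definition rook (k : nat) : rel ('I_k * 'I_k) :=
  [rel p q | (p.1 != q.1) (+) (p.2 != q.2)].

Definition two_hamming (T : finType) (h : rel T) : Prop :=
  exists2 k : nat, 1 <= k & induced_sub h (@rook k).

Definition clique_union (T : finType) (F : rel T) : Prop :=
  forall C : {set T}, C \in components F ->
    {in C &, forall x y : T, x != y -> F x y}.

(* The unordered pair [{F1, F2}] is encoded by either of its two orderings. *)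
Definition hamming_decomp (T : finType) (h F1 F2 : rel T) : Prop :=
  [/\ is_graph F1 /\ is_graph F2,
      forall x y : T, ~~ (F1 x y && F2 x y),
      forall x y : T, h x y = F1 x y || F2 x y
    & clique_union F1 /\ clique_union F2].

Definition is_min (P : nat -> Prop) (m : nat) : Prop :=
  P m /\ forall n : nat, P n -> m <= n.

Definition optimal_decomp (T : finType) (h F1 F2 : rel T) : Prop :=
  hamming_decomp h F1 F2 /\
  is_min (fun k => 1 <= k /\ induced_sub h (@rook k))
         (maxn (ncomp F1) (ncomp F2)).

Definition balanced (T : finType) (h : rel T) : Prop :=
  exists F1 F2 : rel T, optimal_decomp h F1 F2 /\ ncomp F1 = ncomp F2.

Definition chip1 (T : finType) (h' : rel T) (K : {set T}) (u v : T) : Prop :=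
  exists w : T, [/\ #|K| = 3, K = [set u; v; w] & 3 <= deg h' w].

Definition chip2 (T : finType) (h' F1 : rel T) (K : {set T}) (u v : T) : Prop :=
  exists w : T,
    [/\ #|K| = 3, K = [set u; v; w],
        ncomp (del_edges h' (edges_in F1 K)) = 2
      & [set w] \in components (del_edges h' (edges_in F1 K))].

Definition chip3 (T : finType) (h' F1 : rel T) (K : {set T}) (u v : T) : Prop :=
  exists w x : T,
    [/\ #|K| = 4, K = [set u; v; w; x], deg h' w = 3
      & exists2 C : {set T}, C \in components (del_edges h' (edges_in F1 K))
          & K :&: C = [set u]].

Definition chipped (T : finType) (h : rel T) : Prop :=
  exists (h' F1 F2 : rel T) (K : {set T}) (u v : T),
    [/\ is_graph h' /\ connected_graph h', two_hamming h',
        hamming_decomp h' F1 F2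
      & [/\ K \in components F1, #|K| = 3 \/ #|K| = 4, u \in K /\ v \in K
          & [/\ h' u v, h =2 del_edges h' (edge_uv u v)
          & [\/ chip1 h' K u v, chip2 h' F1 K u v | chip3 h' F1 K u v]]]].

Definition condA1 (T : finType) (F1 : rel T) (u v : T) : Prop :=
  deg F1 u = 0 /\ deg F1 v = 0.

Definition condA2 (T : finType) (h F1 F2 : rel T) (u v : T) : Prop :=
  exists (w : T) (A1 A2 A3 : {set T}),
    [/\ h u w /\ h v w,
        let R := components
          (del_edges h (add_edges (edge_uv u w) (edge_uv w v))) in
        #|R| = 3 /\ R = [set A1; A2; A3],
        ncomp_in F1 A1 > ncomp_in F2 A1,
        ncomp_in F1 A2 > ncomp_in F2 A2
      & A3 = [set w]].

Definition classA (T : finType) (h : rel T) : Prop :=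
  [/\ connected_graph h, two_hamming h, ~ balanced h
    & exists F1 F2 : rel T,
      [/\ optimal_decomp h F1 F2, ncomp F1 > ncomp F2
        & exists u v : T, [/\ u != v, ~~ h u v
          & condA1 F1 u v \/ condA2 h F1 F2 u v]]].

(* The index [i] is 1 when the bridge lies in [F1] and 2 when it lies in [F2]. *)
Definition condB1 (T : finType) (h F1 F2 : rel T) (u v : T) : Prop :=
  exists (i : nat) (A1 A2 : {set T}),
    [/\ bridge h u v,
        (i = 1 /\ F1 u v) \/ (i = 2 /\ F2 u v),
        A1 != A2 /\ components (del_edges h (edge_uv u v)) = [set A1; A2],
        ncomp_in F1 A1 >= ncomp_in F2 A1 + i
      & ncomp_in F1 A2 >= ncomp_in F2 A2 + i].

Definition condB2 (T : finType) (h F1 F2 : rel T) (u v : T) : Prop :=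
  exists (w : T) (A1 A2 A3 : {set T}),
    [/\ h u w /\ h v w,
        let R := components (del_edges h (edges_in h [set u; v; w])) in
        #|R| = 3 /\ R = [set A1; A2; A3],
        ncomp_in F1 A1 > ncomp_in F2 A1,
        ncomp_in F1 A2 > ncomp_in F2 A2
      & A3 = [set w]].

Definition classB (T : finType) (h : rel T) : Prop :=
  [/\ connected_graph h, two_hamming h, ~ balanced h
    & exists F1 F2 : rel T,
      [/\ optimal_decomp h F1 F2, ncomp F1 > ncomp F2
        & exists u v : T, h u v /\
            (condB1 h F1 F2 u v \/ condB2 h F1 F2 u v)]].

(* Main.v *)
(* A connected 2-Hamming graph has only one decomposition {F1, F2}: two edges at a
   vertex lie in the same Fi exactly when their other ends are adjacent.  Hence H
   embeds in K_k [] K_k iff k is at least the number of components of F1 and of F2.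
   As K_k [] K_k is transitive on edges and on non-edges, saturation means that H
   does not embed while some H + uv and some H - ab do.

   If uv is an edge of F1 in a 2-Hamming graph H', excluded claws, diamonds and odd
   cycles show that H' - uv is again 2-Hamming only when uv is a whole component of
   F1, or when the component is a triangle uvw with w of degree 2 such that deleting
   the edges of the triangle disconnects u from v.  In the triangle case H' - uv
   arises by exchanging F1 and F2 on the side of v, so its numbers of components
   are explicit; the same exchange applies across a bridge.  Comparing with the
   numbers for H gives conditions a1, a2 (for H + uv) and b1, b2 (for H - ab).
   When H is not 2-Hamming, the same forbidden subgraphs leave only the chipped
   graphs. *)
Require Import Defs.
From mathcomp Require Import all_boot.
From mathcomp Require Import perm zify.

Set Implicit Arguments.
Unset Strict Implicit.
Unset Printing Implicit Defensive.

(** * Counting components *)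

Section Relations.
Variable T : finType.
Implicit Types (h e F G : rel T) (A B C : {set T}) (u v w x y z : T).

(** Uniqueness of the decomposition is needed in a relative form, because a graph has to be compared
    with a modification of it that may be disconnected. For graphs [f] and [g] with a common
    subgraph [e], agreeing on pairs at [e]-distance two, it is constant along walks of [e] whether
    the two colourings agree. Equal graphs give uniqueness; a [g] obtained from [f] by deleting
    edges gives the parity obstruction and, at a bridge, one free bit for each side. The
    inequalities in the two classes come from the following arithmetic. Let [a_i] and [b_i] be the
    numbers of components of [F_i] inside the two sides of a cut vertex. The totals [a_i + b_i + 1]
    become [a1 + b2 + 1] and [a2 + b1 + 1] after the exchange, so the maximum drops exactly when the
    same colour is strictly ahead on both sides. At a bridge only the colour of the bridge has the
    extra one in its old total, so the other colour must be ahead by two: this is the index [i] of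
    b1. Finally [k] is one less than the larger total, while for a chipped graph a single large [k]
    suffices. *)

Lemma edge_uvE u v x y :
  edge_uv u v x y = ((x == u) && (y == v)) || ((x == v) && (y == u)).
Proof.
rewrite /edge_uv /=; apply/eqP/idP => [E | /orP[] /andP[/eqP-> /eqP->]] //; last first.
  by rewrite setUC.
have: x \in [set u; v] by rewrite -E set21.
have: y \in [set u; v] by rewrite -E set22.
have: u \in [set x; y] by rewrite E set21.
have: v \in [set x; y] by rewrite E set22.
rewrite !inE ![u == _]eq_sym ![v == _]eq_sym.
by case: (x == u); case: (x == v); case: (y == u); case: (y == v).
Qed.

Lemma edge_uv_sym u v : symmetric (edge_uv u v).
Proof. by move=> x y; rewrite !edge_uvE orbC ![(y == _) && _]andbC. Qed.

Lemma edge_uvC u v x y : edge_uv u v x y = edge_uv v u x y.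
Proof. by rewrite !edge_uvE orbC. Qed.

Lemma edge_uv_refl u v : edge_uv u v u v.
Proof. by rewrite edge_uvE !eqxx. Qed.

Definition cl F x : {set T} := [set y | connect F x y].

Lemma cl_id F x : x \in cl F x.
Proof. by rewrite inE connect0. Qed.

Lemma mem_components F x : cl F x \in components F.
Proof. by apply/imsetP; exists x. Qed.

Lemma componentsP F C : reflect (exists x, C = cl F x) (C \in components F).
Proof.
by apply: (iffP imsetP) => [[x _ ->]|[x ->]]; exists x.
Qed.

Lemma eq_cl F G : F =2 G -> cl F =1 cl G.
Proof. by move=> E x; apply/setP=> y; rewrite !inE (eq_connect E). Qed.

Lemma eq_components F G : F =2 G -> components F = components G.
Proof. by move=> E; apply: eq_imset; apply: eq_cl. Qed.

Lemma eq_ncomp F G : F =2 G -> ncomp F = ncomp G.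
Proof. by move=> E; rewrite /ncomp (eq_components E). Qed.

Lemma cl_eq F x y : symmetric F -> (cl F x == cl F y) = connect F x y.
Proof.
move=> /sym_connect_sym sF; apply/eqP/idP => [E|c].
  by have := cl_id F y; rewrite -E inE.
by apply/setP=> z; rewrite !inE (same_connect sF c).
Qed.

Lemma ncomp_le_card F : ncomp F <= #|T|.
Proof. exact: leq_imset_card. Qed.

(** Closing a component of the finer [G] under [F] gives a component of [F], and all of them arise
    so; hence [components F] is an image of [components G]. *)
Lemma leq_ncomp F G : symmetric F -> subrel G F -> ncomp F <= ncomp G.
Proof.
move=> sF sub; rewrite /ncomp.
suff ->: components F =
   [set [set y | [exists x in C, connect F x y]] | C : {set T} in components G].
  exact: leq_imset_card.
rewrite -[RHS]imset_comp; apply: eq_imset => x /=.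
apply/setP=> y; rewrite !inE; apply/idP/existsP=> [c|[z]].
  by exists x; rewrite inE connect0.
rewrite inE => /andP[xz]; apply: connect_trans.
by apply: connect_sub xz => a b ab; apply/connect1/sub.
Qed.

(** Components are nonempty, so none lies in both [A] and [B]; the last term counts those that lie
    in neither. *)
Lemma ncomp_split F A B : [disjoint A & B] ->
  ncomp F = ncomp_in F A + ncomp_in F B
    + #|[set C in components F | ~~ (C \subset A) && ~~ (C \subset B)]|.
Proof.
move=> dAB; rewrite /ncomp -(cardsID [set C : {set T} | C \subset A]) -addnA; congr (_ + _).
  by apply: eq_card => C; rewrite !inE.
rewrite -(cardsID [set C : {set T} | C \subset B]); congr (_ + _); apply: eq_card => C.
  rewrite !inE; apply/idP/idP=> [/andP[/andP[_ ->] ->] //|].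
  case/andP=> /componentsP[x ->] sB; rewrite sB mem_components !andbT.
  apply/negP=> /subsetP/(_ _ (cl_id F x)) xA.
  by have := subsetP sB _ (cl_id F x); rewrite (disjointFr dAB xA).
by rewrite !inE; case: (C \in components F); case: (C \subset A); case: (C \subset B).
Qed.

Lemma ncomp_split0 F A B : [disjoint A & B] ->
  (forall x, (cl F x \subset A) || (cl F x \subset B)) ->
  ncomp F = ncomp_in F A + ncomp_in F B.
Proof.
move=> dAB cov; rewrite (ncomp_split F dAB) -[RHS]addn0; congr (_ + _).
apply/eqP; rewrite cards_eq0; apply/eqP/setP=> C; rewrite !inE -negb_or.
by apply/andP=> -[/componentsP[x ->]]; rewrite cov.
Qed.

Lemma ncomp_split1 F A B w : symmetric F -> [disjoint A & B] ->
  (forall x, (cl F x \subset A) || (cl F x \subset B) = ~~ connect F w x) ->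
  ncomp F = ncomp_in F A + ncomp_in F B + 1.
Proof.
move=> sF dAB cov; rewrite (ncomp_split F dAB); congr (_ + _).
rewrite -(cards1 (cl F w)); apply: eq_card => C; rewrite !inE -negb_or.
apply/andP/eqP=> [[/componentsP[x ->]]|->].
  by rewrite cov negbK -(cl_eq _ _ sF) eq_sym => /eqP.
by rewrite cov connect0 mem_components.
Qed.

Lemma ncomp_in_agree F G A :
  (forall x, x \in A -> (cl F x \subset A) || (cl G x \subset A) ->
     cl F x = cl G x) ->
  ncomp_in F A = ncomp_in G A.
Proof.
move=> E; apply: eq_card => C; rewrite !inE.
apply/andP/andP=> -[/componentsP[x ->] sA]; have xA := subsetP sA _ (cl_id _ x).
  have e: cl F x = cl G x by apply: E; rewrite // sA.
  by rewrite {1}e mem_components.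
have e: cl F x = cl G x by apply: E; rewrite // sA orbT.
by rewrite -{1}e mem_components.
Qed.

(** In [F] the component of [u] sticks out of [A] and is not counted; in [G] it has shrunk to a
    singleton, which is. *)
Lemma ncomp_in_add1 F G A u : u \in A -> cl G u = [set u] ->
  ~~ (cl F u \subset A) ->
  (forall x, x \in A -> x != u ->
     (cl F x \subset A) || (cl G x \subset A) -> cl F x = cl G x) ->
  ncomp_in G A = ncomp_in F A + 1.
Proof.
move=> uA clu nF E; rewrite addn1 /ncomp_in.
have nu: [set u] \notin [set C in components F | C \subset A].
  rewrite inE; apply/negP=> /andP[/componentsP[x ux] sA].
  have: x \in [set u] by rewrite ux cl_id.
  by move/set1P=> ?; subst x; rewrite -ux sA in nF.
have := cardsU1 [set u] [set C : {set T} in components F | C \subset A]; rewrite nu add1n => <-.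
apply: eq_card => C; rewrite !inE; apply/andP/orP.
  case=> /componentsP[x ->] sA; have xA := subsetP sA _ (cl_id _ x).
  have [->|xu] := eqVneq x u; first by rewrite clu; left.
  have e: cl F x = cl G x by apply: E; rewrite // sA orbT.
  by right; rewrite -{1}e mem_components.
case=> [/eqP->|/andP[/componentsP[x ->] sA]].
  by rewrite -{1}clu mem_components sub1set.
have xA := subsetP sA _ (cl_id _ x).
have xu: x != u by apply: contraNneq nF => <-.
have e: cl F x = cl G x by apply: E; rewrite // sA.
by rewrite {1}e mem_components.
Qed.

End Relations.

Lemma edge_uv_inj (T U : finType) (f : T -> U) u v x y : injective f ->
  edge_uv (f u) (f v) (f x) (f y) = edge_uv u v x y.
Proof. by move=> fi; rewrite !edge_uvE !(inj_eq fi). Qed.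

Lemma edge_uv_notin (T U : finType) (f : T -> U) a b x y :
  a \notin codom f \/ b \notin codom f -> edge_uv a b (f x) (f y) = false.
Proof.
rewrite edge_uvE => N; apply/negP.
by case/orP=> /andP[/eqP xE /eqP yE]; subst a b; rewrite !codom_f in N; case: N.
Qed.

(** * 2-Hamming decompositions and their uniqueness *)

Section Decompositions.
Variable T : finType.
Implicit Types (h e g F G : rel T) (A B C : {set T}) (u v w x y z : T).

(** First-order form of [clique_union]: together with equality [F] is an equivalence, so components
    are read off from [F] without paths. *)
Definition clique_graph F : Prop :=
  is_graph F /\ forall x y z, F x y -> F y z -> x != z -> F x z.

Lemma clique_graph_connect F x y :
  clique_graph F -> connect F x y = (x == y) || F x y.
Proof.
case=> [[sF irF] tF]; apply/idP/orP=> [|[/eqP->|]]; [|exact: connect0|exact: connect1].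
case/connectP=> p; elim: p x => [|a p IH] x /= => [_ ->|/andP[xa ap] yE].
  by left.
have [->|ne] := eqVneq x y; first by left.
have [/eqP ay|ay] := IH _ ap yE; first by right; rewrite -ay.
by right; apply: tF xa ay ne.
Qed.

Lemma clique_unionP F : is_graph F -> clique_union F <-> clique_graph F.
Proof.
move=> gF; split=> [cF | cgF C /componentsP[x ->] y z].
  split=> // x y z xy yz; apply: (cF (cl F y) (mem_components _ _)).
    by rewrite inE connect1 // gF.1.
  by rewrite inE connect1.
rewrite !inE => xy xz ne; have := clique_graph_connect y z cgF.
rewrite (negPf ne) /= => <-; apply: connect_trans xz.
by rewrite sym_connect_sym //; apply: gF.1.
Qed.

Lemma hamming_decompP h F1 F2 :
  hamming_decomp h F1 F2 <->
  [/\ clique_graph F1, clique_graph F2, forall x y, F1 x y -> F2 x y = false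
    & forall x y, h x y = F1 x y || F2 x y].
Proof.
split=> [[[g1 g2] dis E [c1 c2]]|[c1 c2 dis E]].
  split=> //; [exact/clique_unionP| exact/clique_unionP|].
  by move=> x y f1; have := dis x y; rewrite f1 => /negPf.
split=> //; [by split; [apply: c1.1|apply: c2.1]| |].
  by move=> x y; apply/andP=> -[/dis ->].
by split; [apply/clique_unionP=> //; apply: c1.1|apply/clique_unionP=> //; apply: c2.1].
Qed.

Lemma hamming_decompC h F1 F2 : hamming_decomp h F1 F2 -> hamming_decomp h F2 F1.
Proof.
case=> [[g1 g2] dis E [c1 c2]]; split=> // x y; last by rewrite orbC.
by rewrite andbC.
Qed.

Lemma eq_hamming_decomp h h' F1 F2 :
  h =2 h' -> hamming_decomp h F1 F2 -> hamming_decomp h' F1 F2.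
Proof. by move=> E [? ? H ?]; split=> // x y; rewrite -E. Qed.

Section Given.
Variables (h F1 F2 : rel T).
Hypothesis D : hamming_decomp h F1 F2.

Lemma decomp_clique : clique_graph F1.
Proof. by have /hamming_decompP[] := D. Qed.

Lemma decomp_sym : symmetric F1.
Proof. by case: decomp_clique => [[]]. Qed.

Lemma decomp_irr : irreflexive F1.
Proof. by case: decomp_clique => [[]]. Qed.

Lemma decomp_trans x y z : F1 x y -> F1 y z -> x != z -> F1 x z.
Proof. by case: decomp_clique => _; apply. Qed.

Lemma decomp_disj x y : F1 x y -> F2 x y = false.
Proof. by have /hamming_decompP[_ _ + _] := D; apply. Qed.

Lemma decompE x y : h x y = F1 x y || F2 x y.
Proof. by have /hamming_decompP[_ _ _ +] := D; apply. Qed.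

Lemma decomp_sub x y : F1 x y -> h x y.
Proof. by rewrite decompE => ->. Qed.

Lemma decomp_cl x y : (y \in cl F1 x) = (x == y) || F1 x y.
Proof. by rewrite inE clique_graph_connect //; apply: decomp_clique. Qed.

Lemma decomp_cl_eq x y : (cl F1 x == cl F1 y) = (x == y) || F1 x y.
Proof. by rewrite -decomp_cl inE cl_eq //; apply: decomp_sym. Qed.

End Given.

Lemma decomp_h_sym h F1 F2 : hamming_decomp h F1 F2 -> symmetric h.
Proof.
move=> D x y; rewrite !(decompE D) (decomp_sym D).
by rewrite (decomp_sym (hamming_decompC D)).
Qed.

Lemma decomp_h_irr h F1 F2 : hamming_decomp h F1 F2 -> irreflexive h.
Proof.
move=> D x; rewrite (decompE D) (decomp_irr D).
exact: (decomp_irr (hamming_decompC D)).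
Qed.

Lemma decomp_neq h F1 F2 x y : hamming_decomp h F1 F2 -> h x y -> x != y.
Proof. by move=> D xy; apply: contraTneq xy => ->; rewrite (decomp_h_irr D). Qed.

Lemma decomp_F2 h F1 F2 x y :
  hamming_decomp h F1 F2 -> h x y -> F2 x y = ~~ F1 x y.
Proof.
move=> D; rewrite (decompE D); case f1: (F1 x y) => //= _.
exact: (decomp_disj D f1).
Qed.

(** Two edges of one colour at [b] lie in one clique. If the colours differ, an edge [ac] would
    share its colour with one of them and pull the other into the same clique. *)
Lemma decomp_color h F1 F2 a b c : hamming_decomp h F1 F2 ->
  h b a -> h b c -> a != c -> (F1 b a == F1 b c) = h a c.
Proof.
move=> D ba bc ac; have D' := hamming_decompC D.
case f1: (F1 b a); case f1': (F1 b c).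
- by rewrite (decompE D) (decomp_trans D _ f1') // (decomp_sym D).
- have f2': F2 b c by rewrite (decomp_F2 D bc) f1'.
  symmetry; apply/negP; rewrite (decompE D) => /orP[f|f].
    by rewrite (decomp_trans D f1 f) ?(decomp_neq D bc) in f1'.
  rewrite (decomp_sym D') in f.
  have f2: F2 b a by apply: (decomp_trans D' f2' f); rewrite (decomp_neq D).
  by rewrite (decomp_F2 D) ?f1 in f2.
- have f2: F2 b a by rewrite (decomp_F2 D ba) f1.
  symmetry; apply/negP; rewrite (decompE D) => /orP[f|f].
    rewrite (decomp_sym D) in f.
    by rewrite (decomp_trans D f1' f) ?(decomp_neq D ba) in f1.
  have f2': F2 b c by apply: (decomp_trans D' f2 f); rewrite (decomp_neq D).
  by rewrite (decomp_F2 D) ?f1' in f2'.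
have f2: F2 b a by rewrite (decomp_F2 D ba) f1.
have f2': F2 b c by rewrite (decomp_F2 D bc) f1'.
by rewrite (decompE D) (decomp_trans D' _ f2') ?orbT // (decomp_sym D').
Qed.

(** Decompositions are built from two labellings, the row and the column of each vertex; a colour
    consists of the pairs with equal label. *)
Definition ker_rel (L : eqType) (r : T -> L) : rel T :=
  [rel x y | (x != y) && (r x == r y)].

Lemma ker_relE (L : eqType) (r : T -> L) x y :
  ker_rel r x y = (x != y) && (r x == r y).
Proof. by []. Qed.

Lemma ker_rel_clique (L : eqType) (r : T -> L) : clique_graph (ker_rel r).
Proof.
split; first split=> [x y|x] /=.
- by rewrite !ker_relE eq_sym [r x == _]eq_sym.
- by rewrite ker_relE eqxx.
move=> x y z; rewrite !ker_relE.
by move=> /andP[_ /eqP->] /andP[_ /eqP->] ->; rewrite eqxx.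
Qed.

Lemma label_decomp (L1 L2 : eqType) (r : T -> L1) (c : T -> L2) h :
  irreflexive h ->
  (forall x y, x != y -> r x = r y -> c x = c y -> False) ->
  (forall x y, x != y -> h x y = (r x == r y) || (c x == c y)) ->
  hamming_decomp h (ker_rel r) (ker_rel c).
Proof.
move=> ir inj E; apply/hamming_decompP; split; try exact: ker_rel_clique.
  move=> x y; rewrite !ker_relE => /andP[xy /eqP rxy]; rewrite xy /=.
  by apply/negbTE/eqP; apply: inj.
move=> x y; rewrite !ker_relE -andb_orr.
by have [->|/E] := eqVneq x y; first by rewrite ir.
Qed.

Lemma ncomp_ker_rel (L : finType) (r : T -> L) : ncomp (ker_rel r) <= #|L|.
Proof.
have sub: components (ker_rel r) \subset [set [set y | r y == l] | l : L].
  apply/subsetP=> C /componentsP[x ->]; apply/imsetP; exists (r x) => //.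
  apply/setP=> y; rewrite !inE clique_graph_connect; last exact: ker_rel_clique.
  rewrite ker_relE; have [->|/= _] := eqVneq x y; first by rewrite eqxx.
  by rewrite eq_sym.
exact: leq_trans (subset_leq_card sub) (leq_imset_card _ _).
Qed.

Lemma decomp_embed h F1 F2 k : hamming_decomp h F1 F2 -> 0 < k ->
  ncomp F1 <= k -> ncomp F2 <= k -> induced_sub h (@rook k).
Proof.
case: k => // k D _ n1 n2; have D' := hamming_decompC D.
(* The coordinates of [x] are the positions of its two components in an enumeration. [inord] never
   takes its default value, as there are at most [k.+1] components. *)
pose idx (F : rel T) x : 'I_k.+1 := inord (index (cl F x) (enum (components F))).
have idxE F x y : ncomp F <= k.+1 -> (idx F x == idx F y) = (cl F x == cl F y).
  move=> le; apply/eqP/eqP=> [/(congr1 val)|cE]; last by rewrite /idx cE.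
  have lt z : index (cl F z) (enum (components F)) < k.+1.
    apply: leq_trans le; rewrite /ncomp cardE index_mem mem_enum.
    exact: mem_components.
  rewrite /= !inordK // => /(congr1 (nth set0 (enum (components F)))).
  by rewrite !nth_index ?mem_enum ?mem_components.
exists (fun x => (idx F1 x, idx F2 x)); split.
  move=> x y [/eqP + /eqP]; rewrite !idxE // (decomp_cl_eq D) (decomp_cl_eq D').
  case: eqP => //= _ f1; by rewrite (decomp_disj D f1).
move=> x y; rewrite /rook /= !idxE // (decomp_cl_eq D) (decomp_cl_eq D').
have [->|/= ne] := eqVneq x y; first exact: (decomp_h_irr D).
rewrite (decompE D); case f1: (F1 x y) => /=; last by case: (F2 x y).
by rewrite (decomp_disj D f1).
Qed.

Lemma embed_decomp h k : induced_sub h (@rook k) ->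
  exists F1 F2, [/\ hamming_decomp h F1 F2, ncomp F1 <= k & ncomp F2 <= k].
Proof.
case=> f [fi E]; exists (ker_rel (fun x => (f x).1)), (ker_rel (fun x => (f x).2)).
split; [|by rewrite -[leqRHS]card_ord ncomp_ker_rel..].
apply: label_decomp => [x|x y /eqP xy e1 e2|x y xy].
- by rewrite E /rook /= !eqxx.
- by apply: xy; apply: fi; move: e1 e2; case: (f x); case: (f y) => ? ? ? ? /= -> ->.
rewrite E /rook /=; case: eqP => //= e1; case: eqP => //= e2.
case/eqP: xy; apply: fi; move: e1 e2.
by case: (f x); case: (f y) => ? ? ? ? /= -> ->.
Qed.

Lemma two_hammingP h :
  two_hamming h <-> exists F1 F2, hamming_decomp h F1 F2.
Proof.
split=> [[k _ /embed_decomp[F1 [F2 [D _ _]]]]|[F1 [F2 D]]]; first by exists F1, F2.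
by exists #|T|.+1 => //; apply: (decomp_embed D); rewrite // ltnW // ltnS ncomp_le_card.
Qed.

(** Each colour has at most [#|T|] components, so a finite search for an embedding into one grid
    decides the matter; the successor keeps its side positive when [T] is empty. *)
Lemma two_hamming_dec h : two_hamming h \/ ~ two_hamming h.
Proof.
pose b := [exists f : {ffun T -> 'I_#|T|.+1 * 'I_#|T|.+1},
  injectiveb f && [forall x, forall y, h x y == rook (f x) (f y)]].
case E: b; [left|right].
  have /existsP[f /andP[/injectiveP fi /forallP fE]] := E.
  exists #|T|.+1 => //; exists f; split=> // x y.
  by have /forallP/(_ y)/eqP := fE x.
case/two_hammingP=> F1 [F2 D].
have [||f [fi fE]] := decomp_embed (k := #|T|.+1) D isT.
- by rewrite ltnW // ltnS ncomp_le_card.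
- by rewrite ltnW // ltnS ncomp_le_card.
case/negP: (negbT E); apply/existsP; exists [ffun x => f x]; apply/andP; split.
  by apply/injectiveP=> x y; rewrite !ffunE; apply: fi.
by apply/forallP=> x; apply/forallP=> y; rewrite !ffunE fE.
Qed.

(* Two edges at a vertex have the same colour exactly when their other ends are
   adjacent, so colours propagate along walks of [e] as soon as the two graphs
   agree on pairs at [e]-distance two. *)
Lemma color_propagation f F1 F2 g G1 G2 e :
  hamming_decomp f F1 F2 -> hamming_decomp g G1 G2 -> symmetric e ->
  subrel e f -> subrel e g ->
  (forall a b c, e a b -> e b c -> a != c -> f a c = g a c) ->
  forall x y x' y', connect e x y -> e x x' -> e y y' ->
    (F1 x x' == G1 x x') = (F1 y y' == G1 y y').
Proof.
move=> DF DG se ef eg agree x y x' y' xy xx'.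
have step b a c : e b a -> e b c -> (F1 b a == G1 b a) = (F1 b c == G1 b c).
  move=> ba bc; have [->//|ac] := eqVneq a c.
  have cF := decomp_color DF (ef _ _ ba) (ef _ _ bc) ac.
  have cG := decomp_color DG (eg _ _ ba) (eg _ _ bc) ac.
  have := agree a b c; rewrite se ba bc => /(_ isT isT ac); rewrite -cF -cG.
  by case: (F1 b a); case: (F1 b c); case: (G1 b a); case: (G1 b c).
case/connectP: xy => p; elim: p x x' xx' y y' => [|a p IH] x x' xx' y y' /=.
  by move=> _ -> yy'; apply: step.
case/andP=> xa ap yE yy'; rewrite (step x x' a) //.
rewrite (decomp_sym DF) (decomp_sym DG); apply: (IH a x) => //.
by rewrite se.
Qed.

(** One edge in the component of [u] determines the bit for all others; a component without edges
    accepts either bit. *)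
Lemma color_dichotomy f F1 F2 g G1 G2 e u :
  hamming_decomp f F1 F2 -> hamming_decomp g G1 G2 -> symmetric e ->
  subrel e f -> subrel e g ->
  (forall a b c, e a b -> e b c -> a != c -> f a c = g a c) ->
  exists b : bool, forall x y, connect e u x -> e x y -> G1 x y = b (+) F1 x y.
Proof.
move=> DF DG se ef eg agree.
case: (pickP (fun p => connect e u p.1 && e p.1 p.2)) => [[a c] /= /andP[ua ac] | none]; last first.
  by exists true => x y ux xy; have := none (x, y); rewrite /= ux xy.
exists (F1 a c != G1 a c) => x y ux xy.
have ax : connect e a x by apply: connect_trans ux; rewrite sym_connect_sym.
have := color_propagation DF DG se ef eg agree ax ac xy.
by case: (F1 a c); case: (G1 a c); case: (F1 x y); case: (G1 x y).
Qed.

Lemma decomp_eq h F1 F2 G1 G2 :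
  hamming_decomp h F1 F2 -> hamming_decomp h G1 G2 ->
  (forall x y, h x y -> F1 x y = G1 x y) -> F1 =2 G1 /\ F2 =2 G2.
Proof.
move=> DF DG E; have DF' := hamming_decompC DF; have DG' := hamming_decompC DG.
split=> x y; case xy: (h x y).
- exact: E.
- by apply/idP/idP=> [/(decomp_sub DF)|/(decomp_sub DG)]; rewrite xy.
- by rewrite (decomp_F2 DF xy) (decomp_F2 DG xy) E.
by apply/idP/idP=> [/(decomp_sub DF')|/(decomp_sub DG')]; rewrite xy.
Qed.

(** Comparing [h] with itself makes the agreement at distance two trivial, and connectedness leaves
    a single bit: equality or exchange of the colours. *)
Lemma decomp_unique h F1 F2 G1 G2 : (forall x y, connect h x y) ->
  hamming_decomp h F1 F2 -> hamming_decomp h G1 G2 ->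
  (G1 =2 F1 /\ G2 =2 F2) \/ (G1 =2 F2 /\ G2 =2 F1).
Proof.
move=> conn DF DG.
case: (pickP (fun _ : T => true)) => [u _|none]; last first.
  by left; split=> x; have := none x.
have agree a b c : h a b -> h b c -> a != c -> h a c = h a c by [].
have [b E] := color_dichotomy u DF DG (decomp_h_sym DF) (fun _ _ => id) (fun _ _ => id) agree.
case: b E => E; [right|left].
  apply: (decomp_eq DG (hamming_decompC DF)) => x y xy.
  by rewrite E ?conn // (decomp_F2 DF xy).
by apply: (decomp_eq DG DF) => x y xy; rewrite E ?conn.
Qed.

End Decompositions.

(** * Exchanging the two sides at a cut vertex *)

Section Surgery.
Variable T : finType.
Implicit Types (h e g F G : rel T) (A B C : {set T}) (u v w x y z : T).

Lemma clique_cl F x y : clique_graph F -> (y \in cl F x) = (x == y) || F x y.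
Proof. by move=> cF; rewrite inE clique_graph_connect. Qed.

Lemma clique_sym F : clique_graph F -> symmetric F.
Proof. by case=> [[]]. Qed.

(** A clique that meets both sides contains [w], so only the component of [w] lies in neither side;
    it is the final one. *)
Lemma ncomp_cut F A B w : clique_graph F -> [disjoint A & B] ->
  (forall x, (x \in A) || (x \in B) = (x != w)) ->
  (forall x y, x \in A -> y \in B -> F x y -> F x w) ->
  ncomp F = ncomp_in F A + ncomp_in F B + 1.
Proof.
move=> cF dAB cov exit; have sF := clique_sym cF.
apply: (ncomp_split1 (w := w)) => // x; rewrite clique_graph_connect //.
have wAB : (w \in A) || (w \in B) = false by rewrite cov eqxx.
rewrite sF eq_sym; apply/idP/idP.
  have [wA wB] := norP (negbT wAB).
  case/orP=> /subsetP s; apply/negP=> xw; have := s w; rewrite clique_cl // xw.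
    by rewrite (negPf wA) => /(_ isT).
  by rewrite (negPf wB) => /(_ isT).
case/norP=> xw nxw; move: (cov x); rewrite xw; case/orP=> xAB; apply/orP.
  left; apply/subsetP=> y; rewrite clique_cl // => /orP[/eqP<- //|xy].
  have := cov y; have -> : y != w by apply: contraTneq xy => ->.
  by case/orP=> // yB; rewrite (exit x y) in nxw.
right; apply/subsetP=> y; rewrite clique_cl // => /orP[/eqP<- //|xy].
have := cov y; have -> : y != w by apply: contraTneq xy => ->.
case/orP=> // yA; have yw : F y w by apply: exit yA xAB _; rewrite sF.
by case/negP: nxw; apply: cF.2 xy yw xw.
Qed.

(** A clique leaving [A] contains [w]. Hence the values inside [A] and towards [w] decide which
    cliques stay in [A], and [F] and [G] share these values. *)
Lemma ncomp_in_cut F G A w : clique_graph F -> clique_graph G -> w \notin A ->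
  {in A &, F =2 G} -> {in A, forall x, F x w = G x w} ->
  (forall x y, x \in A -> y \notin A -> F x y -> F x w) ->
  (forall x y, x \in A -> y \notin A -> G x y -> G x w) ->
  ncomp_in F A = ncomp_in G A.
Proof.
move=> cF cG wA FG FGw exF exG; apply: ncomp_in_agree => x xA s.
have xw : x != w by apply: contraNneq wA => <-.
have nFw : F x w = false.
  case/orP: s => /subsetP/(_ w); rewrite clique_cl // (negPf wA) -?FGw //.
    by case: (F x w) => //; rewrite orbT => /(_ isT).
  by case: (F x w) => //; rewrite orbT => /(_ isT).
apply/setP=> y; rewrite !clique_cl //; congr (_ || _).
case yA: (y \in A); first exact: FG.
case fxy: (F x y); first by rewrite (exF x y) ?yA in nFw.
case gxy: (G x y) => //; first by rewrite FGw ?(exG x y) ?yA in nFw.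
Qed.

(* View [h] as the line graph of the bipartite graph whose two sides are the
   components of [F1] and of [F2].  Exchanging the two sides on the edge set [A]
   while keeping it attached to the edge [w] with the ends of [w] swapped, turns a
   path [u - w - v] with [v] in [A] into a triangle, and conversely. *)
Definition flip_adj h F1 F2 A w : rel T := fun x y =>
  if [|| (x \in A) == (y \in A), x == w | y == w] then h x y
  else if y \in A then (F1 x w && F2 y w) || (F2 x w && F1 y w)
  else (F1 y w && F2 x w) || (F2 y w && F1 x w).

(** Row labels after the exchange: [F2]-components on [A], [F1]-components elsewhere, tagged so that
    equal sets of the two kinds stay apart. The [F2]-neighbours of [w] in [A] receive the label of
    [w], which attaches [A] to the other end of [w]. *)
Definition flip_label F1 F2 A w x : bool * {set T} :=
  if x \in A then if F2 x w then (false, cl F1 w) else (true, cl F2 x)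
  else (false, cl F1 x).

(** The hypotheses say that a clique crossing the boundary of [A] contains [w]. The new colour is
    [F1] on [B], [F2] on [A], and crosses only inside the clique of [w], so the counts at a cut
    vertex apply to it as well. *)
Lemma flip_label_cut h F1 F2 A w : hamming_decomp h F1 F2 -> w \notin A ->
  (forall x y, x \notin A -> x != w -> y \in A -> F1 x y -> F1 x w) ->
  (forall x y, x \notin A -> x != w -> y \in A -> F2 x y -> F2 x w) ->
  let B := ~: (w |: A) in let G := ker_rel (flip_label F1 F2 A w) in
  [/\ {in B &, F1 =2 G} /\ {in A &, F2 =2 G},
      {in B, forall x, F1 x w = G x w} /\ {in A, forall x, F2 x w = G x w},
      {in B & A, forall x y, G x y = F1 x w && F2 y w},
      ncomp F1 = ncomp_in F1 B + ncomp_in F1 A + 1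
    & ncomp G = ncomp_in F1 B + ncomp_in F2 A + 1].
Proof.
move=> D wA ex1 ex2 B G; have D' := hamming_decompC D.
have c1 := decomp_clique D; have c2 := decomp_clique D'.
have cG : clique_graph G by apply: ker_rel_clique.
have inB x : (x \in B) = (x != w) && (x \notin A) by rewrite !inE negb_or.
have dBA : [disjoint B & A].
  by rewrite disjoint_sym disjoints_subset; apply/subsetP=> x xA; rewrite inE inB xA andbF.
have cov x : (x \in B) || (x \in A) = (x != w).
  rewrite inB; have [->|xw] /= := eqVneq x w; first exact: negbTE.
  by case: (x \in A).
have irr F : clique_graph F -> forall x, F x x = false by case=> [[]].
have GB : {in B &, F1 =2 G}.
  move=> x y; rewrite !inB => /andP[_ /negPf xA] /andP[_ /negPf yA].
  rewrite /G ker_relE /flip_label xA yA xpair_eqE /= (decomp_cl_eq D).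
  by have [->|] := eqVneq x y; rewrite // irr.
have GA : {in A &, F2 =2 G}.
  move=> x y xA yA; rewrite /G ker_relE /flip_label xA yA.
  have [->|xy] := eqVneq x y; first by rewrite irr.
  case f: (F2 x w); case f': (F2 y w) => /=; rewrite ?xpair_eqE ?eqxx //=.
  - by rewrite (decomp_trans D' f) // (decomp_sym D').
  - apply: contraFF f' => xy2; rewrite (decomp_trans D' _ f) //.
      by rewrite (decomp_sym D').
    by apply: contraTneq yA => ->.
  - apply: contraFF f => xy2; rewrite (decomp_trans D' xy2) //.
    by apply: contraTneq xA => ->.
  by rewrite (decomp_cl_eq D') (negPf xy).
have GBw : {in B, forall x, F1 x w = G x w}.
  move=> x; rewrite inB => /andP[xw /negPf xA].
  rewrite /G ker_relE /flip_label xA (negPf wA) xpair_eqE (decomp_cl_eq D).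
  by rewrite (negPf xw).
have GAw : {in A, forall x, F2 x w = G x w}.
  move=> x xA; have xw : x != w by apply: contraTneq xA => ->.
  rewrite /G ker_relE /flip_label xA (negPf wA) xw /=.
  by case: (F2 x w); rewrite xpair_eqE ?eqxx.
have GBA : {in B & A, forall x y, G x y = F1 x w && F2 y w}.
  move=> x y; rewrite inB => /andP[xw xA] yA.
  have xy : x != y by apply: contraTneq yA => <-.
  rewrite /G ker_relE /flip_label (negPf xA) yA xy.
  case: (F2 y w); rewrite xpair_eqE ?andbF //= andbT.
  by rewrite (decomp_cl_eq D) (negPf xw).
have exG x y : x \in B -> y \in A -> G x y -> G x w.
  by move=> xB yA; rewrite GBA // -GBw // => /andP[].
have sG := clique_sym cG.
have exGA x y : x \in A -> y \notin A -> G x y -> G x w.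
  move=> xA yA xy; have [<- //|yw] := eqVneq y w.
  have yB : y \in B by rewrite inB yw.
  by move: xy; rewrite sG GBA // -GAw // => /andP[].
have exGB x y : x \in B -> y \notin B -> G x y -> G x w.
  move=> xB yB xy; have := cov y; rewrite (negPf yB) /=.
  have [<- //|_ yA] := eqVneq y w; exact: exG xy.
have exFB x y : x \in B -> y \notin B -> F1 x y -> F1 x w.
  move=> xB yB xy; have := cov y; rewrite (negPf yB) /=.
  have [<- //|_ yA] := eqVneq y w.
  by move: xB; rewrite inB => /andP[xw xA]; apply: ex1 xy.
have exFA x y : x \in A -> y \notin A -> F2 x y -> F2 x w.
  move=> xA yA xy; have [<- //|yw] := eqVneq y w.
  rewrite (decomp_sym D') in xy; have yw2 := ex2 y x yA yw xA xy.
  rewrite (decomp_sym D') in xy; apply: (decomp_trans D' xy yw2).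
  by apply: contraTneq xA => ->.
split=> //.
  apply: (ncomp_cut c1 dBA cov) => x y xB yA.
  by apply: exFB => //; rewrite inB yA andbF.
rewrite (ncomp_cut cG dBA cov exG); congr (_ + _ + _).
  by symmetry; apply: (ncomp_in_cut (w := w) c1 cG) => //; rewrite inB eqxx.
by symmetry; apply: (ncomp_in_cut (w := w) c2 cG).
Qed.

(** The second colour is the same labelling with [F1] and [F2] interchanged. *)
Lemma flip_decomp h F1 F2 A w : hamming_decomp h F1 F2 -> w \notin A ->
  (forall x y, x \notin A -> x != w -> y \in A -> F1 x y -> F1 x w) ->
  (forall x y, x \notin A -> x != w -> y \in A -> F2 x y -> F2 x w) ->
  let B := ~: (w |: A) in exists G1 G2,
  [/\ hamming_decomp (flip_adj h F1 F2 A w) G1 G2,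
      ncomp F1 = ncomp_in F1 B + ncomp_in F1 A + 1,
      ncomp F2 = ncomp_in F2 B + ncomp_in F2 A + 1,
      ncomp G1 = ncomp_in F1 B + ncomp_in F2 A + 1
    & ncomp G2 = ncomp_in F2 B + ncomp_in F1 A + 1].
Proof.
move=> D wA ex1 ex2 B; have D' := hamming_decompC D.
have [[b1 a1] [bw1 aw1] ba1 n1 m1] := flip_label_cut D wA ex1 ex2.
have [[b2 a2] [bw2 aw2] ba2 n2 m2] := flip_label_cut D' wA ex2 ex1.
exists (ker_rel (flip_label F1 F2 A w)), (ker_rel (flip_label F2 F1 A w)).
split=> //; move: b1 a1 bw1 aw1 ba1 b2 a2 bw2 aw2 ba2 {n1 n2 m1 m2}.
rewrite -/B; set G1 := ker_rel _; set G2 := ker_rel _.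
move=> b1 a1 bw1 aw1 ba1 b2 a2 bw2 aw2 ba2.
have c1 : clique_graph G1 by apply: ker_rel_clique.
have c2 : clique_graph G2 by apply: ker_rel_clique.
have s1 := clique_sym c1; have s2 := clique_sym c2.
have irr F : clique_graph F -> forall x, F x x = false by case=> [[]].
have inB x : x != w -> (x \in B) = (x \notin A) by rewrite !inE negb_or => ->.
have key x y : (G1 x y -> G2 x y = false) /\ flip_adj h F1 F2 A w x y = G1 x y || G2 x y.
  have [->|xy] := eqVneq x y.
    by rewrite !(irr _ c1, irr _ c2) /flip_adj eqxx /= (decomp_h_irr D).
  have [yE|yw] := eqVneq y w.
    subst y; rewrite /flip_adj eqxx !orbT.
    case xA: (x \in A).
      by rewrite -aw1 // -aw2 // orbC -(decompE D); split=> // /(decomp_disj D').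
    have xB : x \in B by rewrite inB // xA.
    by rewrite -bw1 // -bw2 // -(decompE D); split=> // /(decomp_disj D).
  have [xE|xw] := eqVneq x w.
    subst x; rewrite /flip_adj eqxx orbT s1 s2 (decomp_h_sym D).
    case yA: (y \in A).
      by rewrite -aw1 // -aw2 // orbC -(decompE D); split=> // /(decomp_disj D').
    have yB : y \in B by rewrite inB // yA.
    by rewrite -bw1 // -bw2 // -(decompE D); split=> // /(decomp_disj D).
  rewrite /flip_adj (negPf xw) (negPf yw) !orbF.
  case xA: (x \in A); case yA: (y \in A) => /=.
  - by rewrite -a1 // -a2 // orbC -(decompE D); split=> // /(decomp_disj D').
  - have yB : y \in B by rewrite inB // yA.
    rewrite s1 s2 ba1 // ba2 //; split=> // /andP[/(decomp_disj D)->] //.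
  - have xB : x \in B by rewrite inB // xA.
    rewrite ba1 // ba2 //; split=> // /andP[/(decomp_disj D)->] //.
  have xB : x \in B by rewrite inB // xA.
  have yB : y \in B by rewrite inB // yA.
  by rewrite -b1 // -b2 // -(decompE D); split=> // /(decomp_disj D).
by apply/hamming_decompP; split=> // x y; case: (key x y).
Qed.

(* [f] and [g] give the same colour pattern along an [e]-walk from [u] to [z] whose
   end edges are in [F2]; in [g] the walk would close through [w] to an odd
   induced cycle. *)
Lemma no_odd_cycle f F1 F2 g G1 G2 e u z w :
  hamming_decomp f F1 F2 -> hamming_decomp g G1 G2 -> symmetric e ->
  subrel e f -> subrel e g ->
  (forall a b c, e a b -> e b c -> a != c -> f a c = g a c) ->
  (forall y, e u y -> F1 u y = false) -> (forall y, e z y -> F1 z y = false) ->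
  g u w -> g w z -> g u z = false -> u != z ->
  (forall y, e u y -> y != w /\ g w y = false) ->
  (forall y, e z y -> y != w /\ g w y = false) ->
  connect e u z -> False.
Proof.
move=> DF DG se ef eg agree fu fz uw wz nuz uz iu iz c.
have sg := decomp_h_sym DG.
have deg x y : x != y -> connect e x y -> exists a, e x a.
  move=> xy /connectP[[|a p] /=]; first by move=> _ E; rewrite E eqxx in xy.
  by case/andP=> xa _ _; exists a.
have [p up] := deg u z uz c.
have [q zq] : exists q, e z q.
  by apply: (deg z u); rewrite 1?eq_sym // sym_connect_sym.
have := color_propagation DF DG se ef eg agree c up zq; rewrite fu // fz //.
(* [G1] agrees on [up] and [zq]. At [u], at [z] and at [w] the two edges have nonadjacent ends and
   so different colours: three changes of colour cannot be consistent with that agreement. *)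
have [pw gpw] := iu p up; have [qw gqw] := iz q zq.
have := decomp_color DG (eg _ _ up) uw pw; rewrite sg gpw.
have zw : g z w by rewrite sg.
have := decomp_color DG (eg _ _ zq) zw qw; rewrite [g q w]sg gqw.
have wu : g w u by rewrite sg.
have := decomp_color DG wu wz uz; rewrite nuz.
rewrite ![G1 w _](decomp_sym DG).
by case: (G1 u w); case: (G1 z w); case: (G1 u p); case: (G1 z q).
Qed.

(** The three edges at [w] would need pairwise different colours, and there are two. *)
Lemma no_claw g G1 G2 w a b c : hamming_decomp g G1 G2 ->
  g w a -> g w b -> g w c -> a != b -> a != c -> b != c ->
  g a b = false -> g a c = false -> g b c = false -> False.
Proof.
move=> D wa wb wc ab ac bc; rewrite -(decomp_color D wa wb ab).
rewrite -(decomp_color D wa wc ac) -(decomp_color D wb wc bc).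
by case: (G1 w a); case: (G1 w b); case: (G1 w c).
Qed.

(** The triangles [wxu] and [wxv] are monochromatic and share [wx], so [wu] and [wv] have one colour
    and [uv] would be an edge. *)
Lemma no_diamond g G1 G2 u v w x : hamming_decomp g G1 G2 ->
  g w x -> g w u -> g w v -> g x u -> g x v -> u != v -> g u v = false -> False.
Proof.
move=> D wx wu wv xu xv uv; rewrite -(decomp_color D wu wv uv).
have := decomp_color D wx wu (decomp_neq D xu); rewrite xu.
have := decomp_color D wx wv (decomp_neq D xv); rewrite xv.
by case: (G1 w x); case: (G1 w u); case: (G1 w v).
Qed.

End Surgery.

(** * Component counts at cut vertices and bridges *)

Section Cuts.
Variable T : finType.
Implicit Types (h e g F G D : rel T) (A B C K : {set T}) (u v w x y z : T).

Lemma del_edges_sym h D : symmetric h -> symmetric D -> symmetric (del_edges h D).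
Proof. by move=> sh sD x y; rewrite /del_edges /= sh sD. Qed.

Lemma edges_in_sym h A : symmetric h -> symmetric (edges_in h A).
Proof. by move=> sh x y; rewrite /edges_in /= sh; congr (_ && _); rewrite andbC. Qed.

Lemma add_edges_sym h D : symmetric h -> symmetric D -> symmetric (add_edges h D).
Proof. by move=> sh sD x y; rewrite /add_edges /= sh sD. Qed.

(** On a path from [k] every deleted edge ends in [K], so the last such end, or [k] itself, still
    reaches [y]. *)
Lemma connect_del_cover h D K k : (forall x y, connect h x y) -> k \in K ->
  (forall x y, D x y -> y \in K) ->
  forall y, exists2 z, z \in K & connect (del_edges h D) z y.
Proof.
move=> conn kK DK y.
suff S a b p : path h a p -> b = last a p ->
    (exists2 z, z \in K & connect (del_edges h D) z a) ->
    exists2 z, z \in K & connect (del_edges h D) z b.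
  by have /connectP[p hp yE] := conn k y; apply: S hp yE _; exists k.
elim: p a => [|c p IH] a /= => [_ -> //|/andP[ac cp] bE [z zK za]].
apply: IH cp bE _; case Dac: (D a c); first by exists c; rewrite ?(DK a).
by exists z => //; apply: connect_trans za (connect1 _); rewrite /del_edges /= ac Dac.
Qed.

Lemma components_del3 h D u v w : (forall x y, connect h x y) ->
  symmetric (del_edges h D) ->
  (forall x y, D x y -> y \in [set u; v; w]) ->
  let e := del_edges h D in
  components e = [set cl e u; cl e v; cl e w].
Proof.
move=> conn se DK e; apply/setP=> C; rewrite !inE.
apply/componentsP/idP=> [[x ->]|].
  have uK : u \in [set u; v; w] by rewrite !inE eqxx.
  have [z] := connect_del_cover conn uK DK x.
  by rewrite -cl_eq // => + /eqP<-; rewrite !inE => /orP[/orP[]|] /eqP->; rewrite eqxx ?orbT.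
by case/orP=> [/orP[]|] /eqP->; [exists u|exists v|exists w].
Qed.

(** The classes name the components only as sets. Being three, they are those of [u], [v] and [w]; a
    condition imposed on both [A1] and [A2] passes to the components of [u] and [v] in whichever
    order. *)
Lemma three_components h D u v w A1 A2 (P : pred {set T}) :
  (forall x y, connect h x y) -> symmetric (del_edges h D) ->
  (forall x y, D x y -> y \in [set u; v; w]) ->
  let e := del_edges h D in
  #|components e| = 3 -> components e = [set A1; A2; [set w]] -> P A1 -> P A2 ->
  [/\ ~~ connect e u v, cl e w = [set w], P (cl e u) & P (cl e v)].
Proof.
move=> conn se DK e c3 RE P1 P2.
have RE' := components_del3 conn se DK; rewrite -/e in RE'.
have wE : cl e w = [set w].
  have : [set w] \in components e by rewrite RE !inE eqxx !orbT.
  case/componentsP=> x xE; have : x \in [set w] by rewrite xE cl_id.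
  by move/set1P=> ?; subst x.
have card2 (a b : {set T}) : #|[set a; b]| <= 2 by rewrite cards2; case: (_ == _).
have nuv : cl e u != cl e v.
  by apply: contra_eqN c3 => /eqP E; rewrite RE' E setUid neq_ltn ltnS card2.
have nuw : cl e u != [set w].
  apply: contra_eqN c3 => /eqP E; rewrite RE' wE E setUC setUA setUid.
  by rewrite neq_ltn ltnS card2.
have nvw : cl e v != [set w].
  apply: contra_eqN c3 => /eqP E; rewrite RE' wE E -setUA setUid.
  by rewrite neq_ltn ltnS card2.
split=> //; first by rewrite -cl_eq.
  have : cl e u \in components e by rewrite mem_components.
  by rewrite RE !inE (negPf nuw) orbF => /orP[] /eqP->.
have : cl e v \in components e by rewrite mem_components.
by rewrite RE !inE (negPf nvw) orbF => /orP[] /eqP->.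
Qed.

Lemma three_components_card h D u v w :
  (forall x y, connect h x y) -> symmetric (del_edges h D) ->
  (forall x y, D x y -> y \in [set u; v; w]) ->
  let e := del_edges h D in
  ~~ connect e u v -> cl e w = [set w] -> u != w -> v != w ->
  #|components e| = 3 /\ components e = [set cl e u; cl e v; [set w]].
Proof.
move=> conn se DK e nuv wE uw vw.
rewrite (components_del3 conn se DK) -/e wE; split=> //.
have nw x : x != w -> cl e x != [set w].
  by apply: contraNneq => E; rewrite -in_set1 -E cl_id.
rewrite setUC cardsU1 cards2 !inE ![[set w] == _]eq_sym !(negPf (nw _ _)) //=.
by rewrite cl_eq // nuv.
Qed.

(** The exchange at [w] is an involution that adds [uv] to a path and removes it from a triangle;
    this treats both at once. *)
Definition toggle_edge h u v : rel T :=
  fun x y => if edge_uv u v x y then ~~ h u v else h x y.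

(** The component of [v] is joined to the rest only by edges at [w] and possibly by [uv], and the
    neighbours of [w] are [u] and [v]. So exchanging the colours there can change no adjacency
    except that of [uv]. *)
Lemma flip_toggle h F1 F2 D u v w : hamming_decomp h F1 F2 ->
  (forall x y, connect h x y) -> h u w -> h v w -> u != v ->
  symmetric D -> (forall x y, D x y -> y \in [set u; v; w]) ->
  let e := del_edges h D in ~~ connect e u v -> cl e w = [set w] ->
  exists G1 G2,
  [/\ hamming_decomp (toggle_edge h u v) G1 G2,
      ncomp F1 = ncomp_in F1 (cl e u) + ncomp_in F1 (cl e v) + 1,
      ncomp F2 = ncomp_in F2 (cl e u) + ncomp_in F2 (cl e v) + 1,
      ncomp G1 = ncomp_in F1 (cl e u) + ncomp_in F2 (cl e v) + 1
    & ncomp G2 = ncomp_in F2 (cl e u) + ncomp_in F1 (cl e v) + 1].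
Proof.
move=> DF conn uw vw uv sD DK e nuv wE; have DF' := hamming_decompC DF.
have sh := decomp_h_sym DF.
have se : symmetric e by apply: del_edges_sym.
have unw : u != w := decomp_neq DF uw.
have vnw : v != w := decomp_neq DF vw.
have nw x : x != w -> w \notin cl e x.
  by rewrite !inE sym_connect_sym //; have := in_set1 x w; rewrite -wE inE => ->.
have clw x : w \notin cl e x -> x != w.
  by apply: contraNneq => ->; rewrite cl_id.
have BE : ~: (w |: cl e v) = cl e u.
  apply/setP=> x; rewrite !inE negb_or.
  have [->|xw] := eqVneq x w; first by have := nw u unw; rewrite inE => /negPf->.
  apply/idP/idP=> [nvx|ux]; last first.
    apply: contra nuv => vx; apply: connect_trans ux _.
    by rewrite sym_connect_sym.
  have uK : u \in [set u; v; w] by rewrite !inE eqxx.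
  have [z] := connect_del_cover conn uK DK x; rewrite !inE.
  case/orP=> [/orP[]|] /eqP-> //; first by rewrite (negPf nvx).
  by move=> c; have := nw x xw; rewrite inE sym_connect_sym // c.
have uA : u \notin cl e v by rewrite inE sym_connect_sym.
have crossD x y : x \notin cl e v -> x != w -> y \in cl e v -> h x y -> x = u /\ y = v.
  rewrite !inE => xA xw yA xy; have Dxy : D x y.
    apply: contraNT xA => nD; apply: connect_trans yA (connect1 _).
    by rewrite se /e /del_edges /= xy nD.
  have := DK _ _ Dxy; have := DK y x; rewrite sD Dxy => /(_ isT).
  rewrite !inE (negPf xw) orbF => xE yE; split.
    case/orP: xE => /eqP // xE; by rewrite xE connect0 in xA.
  case/orP: yE => [/orP[]|] /eqP // yE; first by rewrite -yE inE yA in uA.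
  by have := nw v vnw; rewrite inE -yE yA.
have wN x : h x w -> x = u \/ x = v.
  move=> xw; have Dxw : D w x.
    apply: contraT => nD; have: x \in cl e w by rewrite inE connect1 // /e /del_edges /= sh xw nD.
    by rewrite wE => /set1P E; rewrite E (decomp_h_irr DF) in xw.
  have := DK _ _ Dxw; rewrite !inE (negPf (decomp_neq DF xw)) orbF.
  by case/orP=> /eqP; [left|right].
have ex E1 E2 : hamming_decomp h E1 E2 -> forall x y,
    x \notin cl e v -> x != w -> y \in cl e v -> E1 x y -> E1 x w.
  move=> DE x y xA xw yA f1; have hxy := decomp_sub DE f1.
  have [xE yE] := crossD x y xA xw yA hxy; subst x y.
  (* The only crossing edge is [uv], and it then lies in the monochromatic triangle [uvw]. *)
  have wv : w != v by rewrite eq_sym.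
  have := decomp_color DE uw hxy wv; rewrite f1 sh vw.
  by move/eqP.
have wA := nw v vnw.
have [G1 [G2 [DG n1 n2 m1 m2]]] := flip_decomp DF wA (ex _ _ DF) (ex _ _ DF').
rewrite BE in n1 n2 m1 m2; exists G1, G2; split=> //.
apply: eq_hamming_decomp DG => x y; rewrite /flip_adj /toggle_edge.
have vA : v \in cl e v by rewrite cl_id.
(* Different colours towards [w] are possible only for the pair [u], [v], and occur there exactly
   when [uv] is not an edge. *)
have cross a y0 : a \notin cl e v -> a != w -> y0 \in cl e v ->
    (F1 a w && F2 y0 w) || (F2 a w && F1 y0 w) =
    if (a == u) && (y0 == v) then ~~ h u v else h a y0.
  move=> xA xw yA; case: ifP => [/andP[/eqP-> /eqP->]|ne].
    rewrite (decomp_F2 DF uw) (decomp_F2 DF vw).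
    have wu : h w u by rewrite sh.
    have wv : h w v by rewrite sh.
    rewrite -(decomp_color DF wu wv uv) ![F1 w _](decomp_sym DF).
    by case: (F1 u w); case: (F1 v w).
  have -> : h a y0 = false.
    by apply: contraFF ne => /(crossD _ _ xA xw yA)[-> ->]; rewrite !eqxx.
  apply: contraFF ne => cr.
  have [hx hy] : h a w /\ h y0 w.
    by rewrite !(decompE DF); case/orP: cr => /andP[-> ->]; rewrite ?orbT.
  case: (wN _ hx) => xE; last by rewrite xE vA in xA.
  case: (wN _ hy) => yE; first by rewrite -yE yA in uA.
  by rewrite xE yE !eqxx.
rewrite edge_uvE; case: ifP => [same|/norP[xyA /norP[xw yw]]].
  case: ifP => // /orP[] /andP[/eqP xE /eqP yE]; subst x y; move: same.
    by rewrite vA (negPf uA) (negPf unw) (negPf vnw).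
  by rewrite vA (negPf uA) (negPf unw) (negPf vnw).
case yA: (y \in cl e v).
  have xA : x \notin cl e v by apply: contraNN xyA => ->; rewrite yA.
  rewrite (cross x y) //; have -> : (x == v) = false.
    by apply: contraNF xA => /eqP->.
  by rewrite orbF.
have xA : x \in cl e v by apply: contraNT xyA => /negPf->; rewrite yA.
rewrite (cross y x) ?yA //; have -> : (x == u) = false.
  by apply: contraNF uA => /eqP<-.
by rewrite /= [(x == v) && _]andbC [h y x]sh.
Qed.

(** If [F u v], another neighbour of [u] in [A] would be adjacent to [v] too, a second exit from
    [A]. So cutting [uv] leaves [u] alone and adds one component inside [A]. *)
Lemma ncomp_in_bridge F G A u v : clique_graph F -> clique_graph G ->
  u \in A -> v \notin A -> {in A &, F =2 G} ->
  (forall x y, x \in A -> y \notin A -> F x y -> x = u /\ y = v) ->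
  (forall x y, x \in A -> y \notin A -> G x y = false) ->
  ncomp_in G A = ncomp_in F A + F u v.
Proof.
move=> cF cG uA vA FG exF exG.
have clE x : x \in A -> ~~ F u v || (x != u) -> cl F x = cl G x.
  move=> xA ne; apply/setP=> y; rewrite !clique_cl //; congr (_ || _).
  case yA: (y \in A); first exact: FG.
  rewrite exG ?yA //; apply/negP=> xy.
  have [xE yE] := exF x y xA (negbT yA) xy; subst x y.
  by rewrite xy eqxx in ne.
case uv: (F u v); last first.
  by rewrite addn0; apply: ncomp_in_agree => x xA _; rewrite clE ?uv.
apply: (@ncomp_in_add1 _ _ _ _ u) => //; last by move=> x xA xu _; rewrite clE ?xu ?orbT.
  apply/setP=> y; rewrite clique_cl // in_set1 eq_sym.
  have [//|yu] /= := eqVneq y u; case yA: (y \in A); last by rewrite exG ?yA.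
  rewrite -FG //; apply/negP=> uy; have yv : F y v.
    by apply: cF.2 uv _; [rewrite clique_sym|apply: contraTneq yA => ->].
  by have [yE _] := exF y v yA vA yv; rewrite yE eqxx in yu.
by apply/negP=> /subsetP/(_ v); rewrite clique_cl // uv orbT (negPf vA) => /(_ isT).
Qed.

Lemma ncomp_bridge F A B u v : clique_graph F -> [disjoint A & B] ->
  (forall x, (x \in A) || (x \in B)) -> u \in A -> v \in B ->
  (forall x y, x \in A -> y \in B -> F x y -> x = u /\ y = v) ->
  ncomp F = ncomp_in F A + ncomp_in F B + F u v.
Proof.
move=> cF dAB cov uA vB exF; have sF := clique_sym cF.
have sub x : ~~ F u v || ~~ connect F u x -> (cl F x \subset A) || (cl F x \subset B).
  rewrite clique_graph_connect // => ne; case/orP: (cov x) => xAB; apply/orP; [left|right];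
    apply/subsetP=> y; rewrite clique_cl // => /orP[/eqP<- //|xy].
    case/orP: (cov y) => // yB; have [xE yE] := exF x y xAB yB xy; subst x y.
    by rewrite xy eqxx in ne.
  rewrite sF in xy; case/orP: (cov y) => // yA.
  have [yE xE] := exF y x yA xAB xy; subst x y.
  by rewrite xy orbT in ne.
case uv: (F u v) in sub *; last by rewrite addn0; apply: ncomp_split0 => // x; apply: sub.
apply: (ncomp_split1 (w := u)) => // x; apply/idP/idP; last by move=> ne; apply: sub.
move=> s; apply/negP=> ux; have ux' : connect F x u by rewrite sym_connect_sym.
have vx : connect F x v by apply: connect_trans ux' (connect1 _).
case/orP: s => /subsetP s; first by have := s v; rewrite inE vx (disjointFl dAB vB) => /(_ isT).
by have := s u; rewrite inE ux' (disjointFr dAB uA) => /(_ isT).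
Qed.

(** Deleting a bridge destroys uniqueness: each side may exchange its colours independently. Equal
    choices only refine [F1] and [F2], so they never lower the counts; unequal choices give the
    exchanged decomposition constructed here. *)
Lemma flip_bridge h F1 F2 u v : hamming_decomp h F1 F2 ->
  (forall x y, connect h x y) -> h u v ->
  let e := del_edges h (edge_uv u v) in ~~ connect e u v ->
  exists G1 G2,
  [/\ hamming_decomp e G1 G2,
      ncomp F1 = ncomp_in F1 (cl e u) + ncomp_in F1 (cl e v) + F1 u v,
      ncomp F2 = ncomp_in F2 (cl e u) + ncomp_in F2 (cl e v) + F2 u v,
      ncomp G1 = ncomp_in F1 (cl e u) + ncomp_in F2 (cl e v) + 1
    & ncomp G2 = ncomp_in F2 (cl e u) + ncomp_in F1 (cl e v) + 1] /\
  forall G1' G2', hamming_decomp e G1' G2' ->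
    [\/ ncomp G1' = ncomp G1 /\ ncomp G2' = ncomp G2,
        ncomp G1' = ncomp G2 /\ ncomp G2' = ncomp G1,
        ncomp F1 <= ncomp G1' /\ ncomp F2 <= ncomp G2'
      | ncomp F1 <= ncomp G2' /\ ncomp F2 <= ncomp G1'].
Proof.
move=> DF conn uv e nuv; have DF' := hamming_decompC DF.
have sh := decomp_h_sym DF.
have se : symmetric e by apply: del_edges_sym => //; apply: edge_uv_sym.
have ec x y : e x y -> connect e x y by apply: connect1.
have sc : connect_sym e by apply: sym_connect_sym.
set A := cl e u; set B := cl e v.
have uA : u \in A by rewrite cl_id.
have vB : v \in B by rewrite cl_id.
have dAB : [disjoint A & B].
  rewrite disjoints_subset; apply/subsetP=> x; rewrite !inE => ux.
  by apply: contra nuv => vx; apply: connect_trans ux _; rewrite sc.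
have cov x : (x \in A) || (x \in B).
  have DK a b : edge_uv u v a b -> b \in [set u; v].
    by rewrite edge_uvE !inE => /orP[] /andP[_ ->]; rewrite ?orbT.
  have [z] := connect_del_cover conn (set21 u v) DK x.
  by rewrite !inE => /orP[] /eqP-> ->; rewrite ?orbT.
have vA : v \notin A by rewrite (disjointFl dAB vB).
have uB : u \notin B by rewrite (disjointFr dAB uA).
have nB x : x \in A -> x \notin B by move=> xA; rewrite (disjointFr dAB xA).
have BA x : x \notin B -> x \in A by have := cov x; case: (x \in A) => //= ->.
have AB x : x \notin A -> x \in B by have := cov x; case: (x \in A).
have cross x y : x \in A -> y \in B -> h x y -> x = u /\ y = v.
  move=> xA yB xy; have : ~~ e x y.
    apply: contraTN yB => xy'; rewrite (disjointFr dAB) //.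
    by move: xA; rewrite !inE => ux; apply: connect_trans ux (ec _ _ xy').
  rewrite /e /del_edges /= xy /= negbK edge_uvE => /orP[] /andP[/eqP xE /eqP yE] //.
  by subst x; rewrite xA in vA.
have eA x y : x \in A -> e x y -> y \in A.
  by rewrite !inE => ux /ec; apply: connect_trans.
have eB x y : x \in B -> e x y -> y \in B.
  by rewrite !inE => ux /ec; apply: connect_trans.
have hA x y : x \in A -> y \in A -> e x y = h x y.
  move=> xA yA; rewrite /e /del_edges /= edge_uvE.
  have -> : (x == v) = false by apply: contraNF vA => /eqP<-.
  have -> : (y == v) = false by apply: contraNF vA => /eqP<-.
  by rewrite /= andbF andbT.
have hB x y : x \in B -> y \in B -> e x y = h x y.
  move=> xB yB; rewrite /e /del_edges /= edge_uvE.
  have -> : (x == u) = false by apply: contraNF uB => /eqP<-.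
  have -> : (y == u) = false by apply: contraNF uB => /eqP<-.
  by rewrite /= andbF andbT.
(* The labels of the exchange on [B]; the tag keeps the two sides unrelated. *)
pose r E1 E2 x : bool * {set T} := if x \in B then (true, cl E2 x) else (false, cl E1 x).
have GA E1 E2 : hamming_decomp h E1 E2 -> {in A &, E1 =2 ker_rel (r E1 E2)}.
  move=> DE x y /nB/negPf xB /nB/negPf yB; rewrite ker_relE /r xB yB xpair_eqE /=.
  by rewrite (decomp_cl_eq DE); have [->|] := eqVneq x y; rewrite ?(decomp_irr DE).
have GB E1 E2 : hamming_decomp h E1 E2 -> {in B &, E2 =2 ker_rel (r E1 E2)}.
  move=> DE x y xB yB; rewrite ker_relE /r xB yB xpair_eqE /=.
  have DE' := hamming_decompC DE.
  by rewrite (decomp_cl_eq DE'); have [->|] := eqVneq x y; rewrite ?(decomp_irr DE').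
have Gx E1 E2 x y : x \in A -> y \in B -> ker_rel (r E1 E2) x y = false.
  by move=> /nB/negPf xB yB; rewrite ker_relE /r xB yB xpair_eqE andbF.
have cG E1 E2 : clique_graph (ker_rel (r E1 E2)) by apply: ker_rel_clique.
have sG E1 E2 := clique_sym (cG E1 E2).
have exA E1 E2 : hamming_decomp h E1 E2 ->
    forall x y, x \in A -> y \notin A -> E1 x y -> x = u /\ y = v.
  by move=> DE x y xA /AB yB /(decomp_sub DE); apply: cross.
have exB E1 E2 : hamming_decomp h E1 E2 ->
    forall x y, x \in B -> y \notin B -> E1 x y -> x = v /\ y = u.
  move=> DE x y xB /BA yA; rewrite (decomp_sym DE) => /(decomp_sub DE).
  by case/cross.
have count E1 E2 : hamming_decomp h E1 E2 ->
    ncomp E1 = ncomp_in E1 A + ncomp_in E1 B + E1 u v /\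
    ncomp (ker_rel (r E1 E2)) = ncomp_in E1 A + ncomp_in E2 B + 1.
  move=> DE; have DE' := hamming_decompC DE.
  have c1 := decomp_clique DE; have c2 := decomp_clique DE'; split.
    by apply: ncomp_bridge => // x y xA yB; apply: exA DE _ _ xA _; rewrite (disjointFl dAB yB).
  rewrite (ncomp_bridge (cG E1 E2) dAB cov uA vB); last first.
    by move=> x y xA yB; rewrite Gx.
  rewrite Gx // addn0 (ncomp_in_bridge c1 (cG E1 E2) uA vA (GA _ _ DE) (exA _ _ DE)); last first.
    by move=> x y xA /AB yB; rewrite Gx.
  rewrite (ncomp_in_bridge c2 (cG E1 E2) vB uB (GB _ _ DE) (exB _ _ DE')); last first.
    by move=> x y xB /BA yA; rewrite sG Gx.
  (* Each side gains a component if its colour contains [uv]; since [uv] has exactly one colour, the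
     two gains add up to one. *)
  rewrite [E2 v u](decomp_sym DE') addnACA; congr (_ + _).
  by rewrite (decomp_F2 DE uv); case: (E1 u v).
have [n1 m1] := count _ _ DF; have [n2 m2] := count _ _ DF'.
exists (ker_rel (r F1 F2)), (ker_rel (r F2 F1)).
have DG : hamming_decomp e (ker_rel (r F1 F2)) (ker_rel (r F2 F1)).
  have key x y : x \in A -> (ker_rel (r F1 F2) x y -> ker_rel (r F2 F1) x y = false)
      /\ e x y = ker_rel (r F1 F2) x y || ker_rel (r F2 F1) x y.
    move=> xA; case/orP: (cov y) => [yA|yB]; last first.
      rewrite !Gx //; split=> //; apply: contraTF yB => /(eA _ _ xA) yA.
      by rewrite (disjointFr dAB).
    rewrite -(GA _ _ DF) // -(GA _ _ DF') // hA // (decompE DF).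
    by split=> // /(decomp_disj DF).
  have key' x y : (ker_rel (r F1 F2) x y -> ker_rel (r F2 F1) x y = false)
      /\ e x y = ker_rel (r F1 F2) x y || ker_rel (r F2 F1) x y.
    case/orP: (cov x) => xAB; first exact: key.
    case/orP: (cov y) => [yA|yB].
      by rewrite [ker_rel (r F1 F2) x y]sG [ker_rel (r F2 F1) x y]sG se; apply: key.
    rewrite -(GB _ _ DF) // -(GB _ _ DF') // hB // (decompE DF) orbC.
    by split=> // /(decomp_disj DF').
  by apply/hamming_decompP; split=> // x y; case: (key' x y).
split=> // G1' G2' DG'.
(* The ends of an [e]-walk are connected in [e], so they are not the pair [u], [v]. *)
have agree a b c : e a b -> e b c -> a != c -> h a c = e a c.
  move=> ab bc ac; rewrite /e /del_edges /= edge_uvE.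
  have abc := connect_trans (ec _ _ ab) (ec _ _ bc).
  case: (h a c) => //=; symmetry; apply/negP=> /orP[] /andP[/eqP aE /eqP cE]; subst a c.
    by rewrite abc in nuv.
  by rewrite sc abc in nuv.
have eh : subrel e h by move=> x y /andP[].
have [b1 bA] := color_dichotomy u DF DG' se eh (fun _ _ => id) agree.
have [b2 bB] := color_dichotomy v DF DG' se eh (fun _ _ => id) agree.
have G2E x y : e x y -> G2' x y = ~~ G1' x y by apply: decomp_F2.
have eG1 := decomp_sub DG'; have eG2 := decomp_sub (hamming_decompC DG').
have inA x : x \in A -> connect e u x by rewrite inE.
have inB x : x \in B -> connect e v x by rewrite inE.
have col x y : e x y -> G1' x y = (if x \in A then b1 else b2) (+) F1 x y.
  move=> xy; case: ifP => xA; first by apply: bA => //; apply: inA.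
  by apply: bB => //; apply/inB/AB; rewrite xA.
have eqn E1 E2 : hamming_decomp e E1 E2 ->
    (forall x y, e x y -> G1' x y = E1 x y) -> ncomp G1' = ncomp E1 /\ ncomp G2' = ncomp E2.
  by move=> DE E; have [e1 e2] := decomp_eq DG' DE E; split; apply: eq_ncomp.
have colG x y : e x y -> ker_rel (r F1 F2) x y = (y \in B) (+) F1 x y.
  move=> xy; case/orP: (cov x) => [xA|xB].
    have yA := eA _ _ xA xy; have /negPf-> := nB _ yA.
    by rewrite -(GA _ _ DF).
  have yB := eB _ _ xB xy; rewrite yB -(GB _ _ DF) //.
  by rewrite (decomp_F2 DF (eh _ _ xy)).
have sideE x y : e x y -> (y \in B) = (x \notin A).
  move=> xy; apply/idP/idP; last by move=> /AB xB; apply: eB xB xy.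
  by apply: contraTN => /eA/(_ xy)/nB.
have colG2 x y : e x y -> ker_rel (r F2 F1) x y = ~~ ker_rel (r F1 F2) x y.
  exact: decomp_F2.
case: b1 b2 col {bA bB} => [] [] col.
- apply: Or44; split; apply: leq_ncomp; rewrite ?(decomp_sym DF) //.
  + exact: decomp_sym DF.
  + move=> x y g; have xy := eG2 _ _ g; move: g; rewrite G2E // col //.
    by rewrite if_same negbK.
  + exact: decomp_sym DF'.
  move=> x y g; have xy := eG1 _ _ g; move: g; rewrite col // if_same.
  by rewrite (decomp_F2 DF (eh _ _ xy)).
- apply: Or42; apply: eqn (hamming_decompC DG) _ => x y xy.
  by rewrite col // colG2 // colG // (sideE x y xy); case: (x \in A); case: (F1 x y).
- apply: Or41; apply: eqn DG _ => x y xy.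
  by rewrite col // colG // (sideE x y xy); case: (x \in A); case: (F1 x y).
apply: Or43; split; apply: leq_ncomp.
- exact: decomp_sym DF.
- by move=> x y g; have xy := eG1 _ _ g; move: g; rewrite col // if_same.
- exact: decomp_sym DF'.
move=> x y g; have xy := eG2 _ _ g; move: g; rewrite G2E // col //.
by rewrite if_same /= (decomp_F2 DF (eh _ _ xy)).
Qed.

End Cuts.

(** * Adding or removing one edge *)

Section EdgeRemoval.
Variable T : finType.
Implicit Types (h e g F G D : rel T) (A B C K : {set T}) (u v w x y z : T).

(** A clique minus a vertex is a clique, so all [F1]-edges at [v] may be deleted together. *)
Lemma isolate_decomp h F1 F2 v : hamming_decomp h F1 F2 ->
  hamming_decomp (fun x y => h x y && ~~ (F1 x y && ((x == v) || (y == v))))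
    (fun x y => [&& F1 x y, x != v & y != v]) F2.
Proof.
move=> D; have D' := hamming_decompC D; apply/hamming_decompP; split.
- split; first split=> [x y|x].
  + by rewrite (decomp_sym D) andbC [LHS]andbC; congr (_ && _); rewrite andbC.
  + by rewrite (decomp_irr D).
  move=> x y z /and3P[xy xv _] /and3P[yz _ zv] xz.
  by rewrite (decomp_trans D xy yz xz) xv zv.
- exact: decomp_clique D'.
- by move=> x y /and3P[/(decomp_disj D)].
move=> x y; rewrite (decompE D); case f1: (F1 x y) => /=; last by rewrite andbT.
by rewrite (decomp_disj D f1) orbF negb_or.
Qed.

Lemma isolate_edge h F1 F2 u v : hamming_decomp h F1 F2 -> F1 u v ->
  (forall y, F1 u y -> y = v) ->
  exists G1, [/\ hamming_decomp (del_edges h (edge_uv u v)) G1 F2,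
    ncomp G1 = ncomp F1 + 1 & forall x y, G1 x y = F1 x y && ~~ edge_uv u v x y].
Proof.
move=> D uv uE; have D' := hamming_decompC D.
have vE y : F1 v y -> y = u.
  move=> vy; apply/eqP/contraT => yu.
  have uy : F1 u y by apply: (decomp_trans D uv vy); rewrite eq_sym.
  by move: vy; rewrite (uE y uy) (decomp_irr D).
have edgeE x y : F1 x y -> ((x == v) || (y == v)) = edge_uv u v x y.
  move=> xy; rewrite edge_uvE; case: (eqVneq x v) => [xE|xv] /=.
    by subst x; rewrite (vE _ xy) eqxx orbT.
  rewrite orbF; case: eqP => [yE|]; last by rewrite andbF.
  by subst y; rewrite (decomp_sym D) in xy; rewrite (vE _ xy) eqxx.
have DI := isolate_decomp v D; have cI := decomp_clique DI.
have uvn : u != v by apply: decomp_neq D (decomp_sub D uv).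
exists (fun x y => [&& F1 x y, x != v & y != v]); split.
- apply: eq_hamming_decomp DI => x y; rewrite /del_edges /=.
  case f1: (F1 x y); first by rewrite edgeE.
  rewrite /= andbT; case hxy: (h x y) => //=; symmetry.
  rewrite edge_uvE; apply/negP=> /orP[] /andP[/eqP xE /eqP yE]; subst x y.
    by rewrite uv in f1.
  by rewrite (decomp_sym D) uv in f1.
- have c1 := decomp_clique D; set G := (fun x y => _).
  (* Counting with [v] as cut vertex and an empty second side; the added one is the component of
     [v]. *)
  pose A := ~: [set v].
  have cnt F : clique_graph F -> ncomp F = ncomp_in F A + ncomp_in F set0 + 1.
    move=> cF; apply: (ncomp_cut (w := v)) => //.
    - by rewrite disjoint_sym disjoints_subset sub0set.
    - by move=> x; rewrite !inE orbF.
    by move=> x y _; rewrite inE.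
  have in0 F : ncomp_in F set0 = 0.
    apply/eqP; rewrite cards_eq0; apply/eqP/setP=> C; rewrite !inE.
    apply/negP=> /andP[/componentsP[x ->]].
    by rewrite subset0 => /eqP/setP/(_ x); rewrite cl_id inE.
  rewrite (cnt G) // (cnt F1) // !in0 !addn0.
  rewrite (@ncomp_in_bridge _ F1 G A u v) ?uv // ?inE ?eqxx //.
  - by move=> x y; rewrite !inE /G => -> ->; rewrite !andbT.
  - move=> x y; rewrite !inE negbK => xv /eqP-> xy; split=> //.
    by apply: vE; rewrite (decomp_sym D).
  by move=> x y; rewrite !inE negbK /G => _ /eqP->; rewrite eqxx !andbF.
by move=> x y; case f1: (F1 x y) => //=; rewrite -edgeE // negb_or.
Qed.

Lemma ncomp_gt0 F : 0 < #|T| -> 0 < ncomp F.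
Proof.
by case/card_gt0P=> x _; apply/card_gt0P; exists (cl F x); apply: mem_components.
Qed.

Lemma connected_embed h F1 F2 k : (forall x y, connect h x y) ->
  hamming_decomp h F1 F2 -> 0 < k ->
  induced_sub h (@rook k) <-> ncomp F1 <= k /\ ncomp F2 <= k.
Proof.
move=> conn D k0; split=> [/embed_decomp[G1 [G2 [DG n1 n2]]]|[n1 n2]].
  by case: (decomp_unique conn DG D) => -[/eq_ncomp-> /eq_ncomp->].
exact: decomp_embed D k0 n1 n2.
Qed.

Lemma connected_optimal h F1 F2 : connected_graph h -> hamming_decomp h F1 F2 ->
  optimal_decomp h F1 F2.
Proof.
case=> T0 conn D; split=> //; have n1 := ncomp_gt0 F1 T0; have n2 := ncomp_gt0 F2 T0.
split=> [|k [k0 /(connected_embed conn D k0)[]]]; last by lia.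
split; first lia.
by apply/(connected_embed conn D); lia.
Qed.

Lemma connected_unbalanced h F1 F2 : connected_graph h -> hamming_decomp h F1 F2 ->
  ncomp F1 != ncomp F2 -> ~ balanced h.
Proof.
case=> _ conn D ne [G1 [G2 [[DG _] E]]]; move: ne; apply/negP; rewrite negbK.
by case: (decomp_unique conn DG D) => -[/eq_ncomp-> /eq_ncomp->]; rewrite E.
Qed.

(** Once [uv] is gone, a further neighbour [y] of [w] gives an induced diamond on [u], [v], [w], [y]
    if [wy] is in [F1], and a claw at [w] otherwise. A connection of [u] and [v] avoiding the
    triangle's edges fails by parity. *)
Lemma chip_structure h F1 F2 G1 G2 u v w : hamming_decomp h F1 F2 ->
  hamming_decomp (del_edges h (edge_uv u v)) G1 G2 -> F1 u v -> F1 u w -> w != v ->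
  [/\ h u w, h v w, forall y, h w y -> y = u \/ y = v
    & ~~ connect (del_edges h (edges_in h [set u; v; w])) u v].
Proof.
move=> D DG uv uw wv; have D' := hamming_decompC D.
have sh := decomp_h_sym D; set g := del_edges h _ in DG.
have nuv : u != v by apply: decomp_neq D (decomp_sub D uv).
have nuw : u != w by apply: decomp_neq D (decomp_sub D uw).
have wvF : F1 w v by apply: (decomp_trans D _ uv wv); rewrite (decomp_sym D).
have wuF : F1 w u by rewrite (decomp_sym D).
have gE x y : g x y = h x y && ~~ edge_uv u v x y by [].
have guv : g u v = false by rewrite gE edge_uv_refl andbF.
have gw y : g w y = h w y.
  by rewrite gE edge_uvE (negPf wv) [w == u]eq_sym (negPf nuw) andbT.
have wN y : h w y -> y = u \/ y = v.
  move=> wy; have [->|yu] := eqVneq y u; first by left.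
  have [->|yv] := eqVneq y v; first by right.
  have wu : h w u by rewrite (decompE D) wuF.
  have wvh : h w v by rewrite (decompE D) wvF.
  have uy := decomp_color D wu wy; rewrite eq_sym yu wuF in uy.
  have vy := decomp_color D wvh wy; rewrite eq_sym yv wvF in vy.
  have gy x : x != y -> h x y = (true == F1 w y) -> g x y = h x y.
    move=> _ _; rewrite gE edge_uvE (negPf yu) (negPf yv) !andbF.
    by rewrite andbT.
  have {}uy := uy isT; have {}vy := vy isT.
  have ux : u != y by rewrite eq_sym.
  have vx : v != y by rewrite eq_sym.
  case f1: (F1 w y) in uy vy.
    exfalso; apply: (no_diamond (w := w) (x := y) DG _ _ _ _ _ nuv guv); rewrite -/g ?gw //.
      by rewrite (decomp_h_sym DG) -/g gy // -uy.
    by rewrite (decomp_h_sym DG) -/g gy // -vy.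
  exfalso; apply: (no_claw (w := w) (a := u) (b := v) (c := y) DG) => //; rewrite -/g ?gw //.
    by rewrite gy // -uy.
  by rewrite gy // -vy.
set e := del_edges h _.
have se : symmetric e by apply: del_edges_sym => //; apply: edges_in_sym.
have uh : h u v by rewrite (decompE D) uv.
have eK x y : x \in [set u; v; w] -> e x y -> y \notin [set u; v; w].
  by move=> xK; rewrite /e /del_edges /edges_in /= xK /= => /andP[->].
have uK : u \in [set u; v; w] by rewrite !inE eqxx.
have vK : v \in [set u; v; w] by rewrite !inE eqxx orbT.
have eh : subrel e h by move=> x y /andP[].
(* An [F1]-neighbour of [u] or [v] outside the triangle would also be a neighbour of [w]. *)
have fK x y : x \in [set u; v] -> e x y -> F1 x y = false.
  move=> xuv xy; apply/negP=> f1.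
  have xK : x \in [set u; v; w] by move: xuv; rewrite !inE => ->.
  have yK := eK x y xK xy.
  have wy : h w y.
    apply: (decomp_sub D); apply: (decomp_trans D _ f1).
      by move: xuv; rewrite !inE => /orP[] /eqP->.
    by apply: contraNneq yK => <-; rewrite !inE eqxx orbT.
  by case: (wN _ wy) => yE; move: yK; rewrite yE ?uK ?vK.
have fu y : e u y -> F1 u y = false by apply: fK; rewrite set21.
have fv y : e v y -> F1 v y = false by apply: fK; rewrite set22.
have iK x y : x \in [set u; v] -> e x y -> y != w /\ g w y = false.
  move=> xuv xy; have xK : x \in [set u; v; w] by move: xuv; rewrite !inE => ->.
  have yK := eK x y xK xy; split.
    by apply: contraNneq yK => ->; rewrite !inE eqxx orbT.
  rewrite gw; apply: contraNF yK => /wN[] ->; exact.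
split=> //; [exact: (decomp_sub D uw)|by rewrite sh; apply: (decomp_sub D wvF)|].
apply/negP; apply: (@no_odd_cycle _ h F1 F2 g G1 G2 e u v w D DG se eh) => //.
- move=> x y xy; rewrite -/g gE eh //=; apply: contraTN xy; rewrite edge_uvE.
  by case/orP=> /andP[/eqP-> /eqP->]; [have := eK u v uK|have := eK v u vK];
    case: (e _ _) => // /(_ isT); rewrite ?uK ?vK.
(* [h] and [g] differ only at [uv]; a common [e]-neighbour of [u] and [v] would have both edges in
   [F2] and force [uv] into [F2]. *)
- move=> a b c ab bc ac; rewrite -/g gE; case E: (edge_uv u v a c); rewrite ?andbT //.
  exfalso; have bu : e u b /\ e v b.
    by move: E; rewrite edge_uvE => /orP[] /andP[/eqP aE /eqP cE]; subst a c; rewrite ![e _ b]se; split=> //; rewrite se.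
  case: bu => eub evb; have f2u : F2 u b by rewrite (decomp_F2 D) ?fu ?eh.
  have f2v : F2 b v by rewrite (decomp_sym D') (decomp_F2 D) ?fv ?eh.
  by have := decomp_trans D' f2u f2v nuv; rewrite (decomp_disj D uv).
- by rewrite -/g (decomp_h_sym DG) -/g gw; apply: (decomp_sub D wuF).
- by rewrite -/g gw; apply: (decomp_sub D wvF).
- by move=> y; apply: iK; rewrite set21.
by move=> y; apply: iK; rewrite set22.
Qed.

End EdgeRemoval.

(** * The classes A and B in terms of component counts *)

Section UnbalancedClasses.
Variable T : finType.
Implicit Types (h e g F G D : rel T) (A B C K : {set T}) (u v w x y z : T).

Lemma eq_induced_sub (U : finType) h h' (g : rel U) :
  h =2 h' -> induced_sub h g -> induced_sub h' g.
Proof. by move=> E [f [fi fE]]; exists f; split=> // x y; rewrite -E. Qed.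

Lemma path_edgesP u v w x y :
  add_edges (edge_uv u w) (edge_uv w v) x y ->
  [/\ x \in [set u; v; w], y \in [set u; v; w] & (x == w) || (y == w)].
Proof.
rewrite /add_edges /= !edge_uvE !inE.
by case/orP=> /orP[] /andP[/eqP-> /eqP->]; rewrite !eqxx ?orbT.
Qed.

Lemma path_edges_sym u v w : symmetric (add_edges (edge_uv u w) (edge_uv w v)).
Proof. by apply: add_edges_sym; apply: edge_uv_sym. Qed.

Lemma add_toggle h u v : ~~ h u v -> add_edges h (edge_uv u v) =2 toggle_edge h u v.
Proof.
by move=> nuv x y; rewrite /add_edges /toggle_edge /=; case: ifP; rewrite ?orbT ?orbF.
Qed.

Lemma del_toggle h u v : h u v -> del_edges h (edge_uv u v) =2 toggle_edge h u v.
Proof.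
by move=> uv x y; rewrite /del_edges /toggle_edge /= uv; case: ifP; rewrite ?andbF ?andbT.
Qed.

Lemma del_add h u v : symmetric h -> ~~ h u v ->
  del_edges (add_edges h (edge_uv u v)) (edge_uv u v) =2 h.
Proof.
move=> sh nuv x y; rewrite /del_edges /add_edges /=.
case E: (edge_uv u v x y); last by rewrite orbF andbT.
rewrite andbF; move: E; rewrite edge_uvE.
by case/orP=> /andP[/eqP-> /eqP->]; rewrite ?[h v u]sh (negPf nuv).
Qed.

Lemma cl_isolated e w : symmetric e -> (forall y, e w y = false) -> cl e w = [set w].
Proof.
move=> se iso; apply/setP=> y; rewrite !inE; apply/idP/eqP=> [|->]; last exact: connect0.
by case/connectP=> -[|a p] /=; [|rewrite iso].
Qed.

(** Here [h] is the enlarged graph minus [uv]. If [uv] is a whole clique there, its ends become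
    singletons, which is a1; otherwise [chip_structure] yields the path of a2. *)
Lemma classA_intro h F1 F2 u v k : (forall x y, connect h x y) ->
  hamming_decomp h F1 F2 -> u != v -> ~~ h u v ->
  k < maxn (ncomp F1) (ncomp F2) ->
  induced_sub (add_edges h (edge_uv u v)) (@rook k) ->
  exists E1 E2, [/\ hamming_decomp h E1 E2, ncomp E2 < ncomp E1
    & condA1 E1 u v \/ condA2 h E1 E2 u v].
Proof.
move=> conn DF uv nuv kn emb; have sh := decomp_h_sym DF.
have DF' := hamming_decompC DF.
set h' := add_edges _ _ in emb.
have huv : h' u v by rewrite /h' /add_edges /= edge_uv_refl orbT.
have [H1 [H2 [DH n1 n2 f1]]] : exists H1 H2,
    [/\ hamming_decomp h' H1 H2, ncomp H1 <= k, ncomp H2 <= k & H1 u v].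
  have [H1 [H2 [DH n1 n2]]] := embed_decomp emb.
  have := huv; rewrite (decompE DH) => /orP[f|f]; first by exists H1, H2.
  by exists H2, H1; split=> //; apply: hamming_decompC.
have delE := del_add sh nuv; rewrite -/h' in delE.
case: (pickP (fun w => H1 u w && (w != v))) => [w /andP[uwH wv]|none]; last first.
  have uE y : H1 u y -> y = v.
    by move=> uy; apply/eqP; have := none y; rewrite uy /= => /negbFE.
  have vE y : H1 v y -> y = u.
    move=> vy; apply/eqP/contraT => yu.
    have uy : H1 u y by apply: (decomp_trans DH f1 vy); rewrite eq_sym.
    by move: vy; rewrite (uE y uy) (decomp_irr DH).
  have [G1 [DG m1 G1E]] := isolate_edge DH f1 uE.
  have {}DG := eq_hamming_decomp delE DG; exists G1, H2; split=> //.
    (* Only the first colour gains a component. As the maximum exceeds [k], that colour has exactly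
       [k + 1] components and is the larger one. *)
    by case: (decomp_unique conn DF DG) => -[/eq_ncomp e1 /eq_ncomp e2]; lia.
  left; split; apply/eqP; rewrite cards_eq0; apply/eqP/setP=> y; rewrite !inE G1E.
    by apply/negP=> /andP[/uE->]; rewrite edge_uv_refl.
  by apply/negP=> /andP[/vE->]; rewrite edge_uvC edge_uv_refl.
have DFd : hamming_decomp (del_edges h' (edge_uv u v)) F1 F2.
  by apply: eq_hamming_decomp DF => x y; rewrite delE.
have [uw' vw' wN' nconn] := chip_structure DH DFd f1 uwH wv.
have uw1 : u != w by apply: (decomp_neq DH uw').
have h'h x y : (x == w) || (y == w) -> h' x y = h x y.
  rewrite /h' /add_edges /= edge_uvE => /orP[] /eqP->.
    by rewrite [w == u]eq_sym (negPf uw1) (negPf wv) /= orbF.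
  by rewrite (negPf wv) [w == u]eq_sym (negPf uw1) !andbF /= orbF.
have uw : h u w by rewrite -h'h ?eqxx ?orbT.
have vw : h v w by rewrite -h'h ?eqxx ?orbT.
have wN y : h w y -> y = u \/ y = v by rewrite -h'h ?eqxx //; apply: wN'.
set D := add_edges (edge_uv u w) (edge_uv w v).
have sD : symmetric D by apply: path_edges_sym.
have DK x y : D x y -> y \in [set u; v; w] by case/path_edgesP.
have se : symmetric (del_edges h D) by apply: del_edges_sym.
have iso : cl (del_edges h D) w = [set w].
  apply: cl_isolated => // y; rewrite /del_edges /=; apply/negP=> /andP[/wN yE].
  by rewrite /D /add_edges /= !edge_uvE; case: yE => ->; rewrite !eqxx ?orbT.
have nc : ~~ connect (del_edges h D) u v.
  apply: contra nconn; apply: connect_sub => x y /andP[xy nD]; apply: connect1.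
  rewrite /del_edges /= {1}/h' /add_edges /= xy /=.
  apply: contra nD; rewrite /edges_in /= !inE => /and3P[_ + +].
  rewrite /D /add_edges /= !edge_uvE.
  by case/orP=> [/orP[]|] /eqP xE; case/orP=> [/orP[]|] /eqP yE; subst x y;
    rewrite ?eqxx ?orbT //; exfalso; move: xy;
    rewrite ?(decomp_h_irr DF) ?(negPf nuv) // sh (negPf nuv).
have [G1 [G2 [DG n3 n4 m1 m2]]] := flip_toggle DF conn uw vw uv sD DK nc iso.
set Cu := cl _ u in n3 n4 m1 m2; set Cv := cl _ v in n3 n4 m1 m2.
have {}DG : hamming_decomp h' G1 G2.
  by apply: eq_hamming_decomp DG => x y; rewrite -add_toggle.
have conn' x y : connect h' x y.
  apply: connect_sub (conn x y) => a b ab; apply: connect1.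
  by rewrite /h' /add_edges /= ab.
have [c3 RE] := three_components_card conn se DK nc iso uw1 (decomp_neq DF vw).
have [k1 k2] : ncomp G1 <= k /\ ncomp G2 <= k.
  by case: (decomp_unique conn' DH DG) => -[/eq_ncomp-> /eq_ncomp->].
(* Both exchanged totals are at most [k] and one old total is larger; cancelling the common side
   shows that its colour is strictly ahead on each side. *)
have [[lt [l1 l2]]|[lt [l1 l2]]] :
    (ncomp F2 < ncomp F1 /\ ncomp_in F2 Cu < ncomp_in F1 Cu /\
       ncomp_in F2 Cv < ncomp_in F1 Cv) \/
    (ncomp F1 < ncomp F2 /\ ncomp_in F1 Cu < ncomp_in F2 Cu /\
       ncomp_in F1 Cv < ncomp_in F2 Cv).
  by move: kn n3 n4 m1 m2 k1 k2; clear; rewrite leq_max /=; lia.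
- by exists F1, F2; split=> //; right; exists w, Cu, Cv, [set w].
by exists F2, F1; split=> //; right; exists w, Cu, Cv, [set w].
Qed.

(** In a1, joining two singletons saves a component of [F1]. In a2, the exchange replaces the
    [F1]-count of one side by the smaller [F2]-count in each total. Either way both totals fall
    below [ncomp F1]. *)
Lemma classA_elim h F1 F2 u v : connected_graph h ->
  hamming_decomp h F1 F2 -> ncomp F2 < ncomp F1 -> u != v -> ~~ h u v ->
  condA1 F1 u v \/ condA2 h F1 F2 u v ->
  induced_sub (add_edges h (edge_uv u v)) (@rook (ncomp F1).-1).
Proof.
move=> [T0 conn] DF lt uv nuv; have sh := decomp_h_sym DF.
have n20 := ncomp_gt0 F2 T0; have DF' := hamming_decompC DF.
case=> [[/eqP u0 /eqP v0]|[w [A1 [A2 [A3 [[uw vw] /= [c3 RE] lt1 lt2 A3E]]]]]].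
  have uN y : F1 u y = false.
    by move: u0; rewrite cards_eq0 => /eqP/setP/(_ y); rewrite !inE.
  have vN y : F1 v y = false.
    by move: v0; rewrite cards_eq0 => /eqP/setP/(_ y); rewrite !inE.
  pose E1 := add_edges F1 (edge_uv u v).
  have uE y : E1 u y -> y = v.
    by rewrite /E1 /add_edges /= uN edge_uvE eqxx (negPf uv) orbF => /eqP.
  have vE y : E1 v y -> y = u.
    by rewrite /E1 /add_edges /= vN edge_uvE eqxx eq_sym (negPf uv) => /eqP.
  have sE : symmetric E1.
    by apply: add_edges_sym; [apply: decomp_sym DF|apply: edge_uv_sym].
  have nF x : F1 x u = false /\ F1 x v = false.
    by rewrite ![F1 x _](decomp_sym DF).
  have edgeE x y : edge_uv u v x y -> E1 x y by rewrite /E1 /add_edges /= => ->; rewrite orbT.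
  have cE : clique_graph E1.
    split; first split=> // x.
      rewrite /E1 /add_edges /= (decomp_irr DF) edge_uvE /=.
      by apply/negP=> /orP[] /andP[/eqP-> E]; rewrite ?[v == u]eq_sym (negPf uv) in E.
    move=> x y z xy yz xz; move: (xy) (yz); rewrite /E1 /add_edges /=.
    case/orP=> [xyF|]; last first.
      rewrite edge_uvE => /orP[] /andP[/eqP xE /eqP yE]; subst x y.
        by have zE := vE _ yz; rewrite zE eqxx in xz.
      by have zE := uE _ yz; rewrite zE eqxx in xz.
    case/orP=> [yzF|]; first by rewrite (decomp_trans DF xyF yzF xz).
    rewrite edge_uvE => /orP[] /andP[/eqP yE _]; subst y; have [a b] := nF x.
      by rewrite a in xyF.
    by rewrite b in xyF.
  have DE : hamming_decomp (add_edges h (edge_uv u v)) E1 F2.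
    apply/hamming_decompP; split=> //; first exact: decomp_clique DF'.
      move=> x y /orP[/(decomp_disj DF) //|]; rewrite edge_uvE => ed.
      apply: contraNF nuv => f2; have := decomp_sub DF' f2.
      by case/orP: ed => /andP[/eqP-> /eqP->] //; rewrite sh.
    move=> x y; rewrite /E1 /add_edges /= (decompE DF).
    by case: (F1 x y); case: (F2 x y); case: (edge_uv u v x y).
  (* The count of [E1] is found backwards: isolating [uv] in it restores [F1] and adds one
     component. *)
  have [G1 [_ m1 G1E]] := isolate_edge DE (edgeE u v (edge_uv_refl u v)) uE.
  have GF : ncomp G1 = ncomp F1.
    apply: eq_ncomp => x y; rewrite G1E /E1 /add_edges /=.
    case ed: (edge_uv u v x y); last by rewrite orbF andbT.
    rewrite andbF; move: ed; rewrite edge_uvE => /orP[] /andP[/eqP-> _].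
      by rewrite uN.
    by rewrite vN.
  by apply: (decomp_embed DE); move: n20 lt m1 GF; clear; lia.
subst A3; set D := add_edges (edge_uv u w) (edge_uv w v) in c3 RE.
have sD : symmetric D by apply: path_edges_sym.
have DK x y : D x y -> y \in [set u; v; w] by case/path_edgesP.
have se : symmetric (del_edges h D) by apply: del_edges_sym.
have [nc iso l1 l2] :=
  @three_components T h D u v w A1 A2 (fun A => ncomp_in F2 A < ncomp_in F1 A)
    conn se DK c3 RE lt1 lt2.
have [G1 [G2 [DG n3 n4 m1 m2]]] := flip_toggle DF conn uw vw uv sD DK nc iso.
have {}DG : hamming_decomp (add_edges h (edge_uv u v)) G1 G2.
  by apply: eq_hamming_decomp DG => x y; rewrite -add_toggle.
by apply: (decomp_embed DG); move: n20 lt n3 n4 m1 m2 l1 l2; clear; lia.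
Qed.

Lemma bridge_components h u v : symmetric h -> (forall x y, connect h x y) -> h u v ->
  let e := del_edges h (edge_uv u v) in components e = [set cl e u; cl e v].
Proof.
move=> sh conn uv e.
have se : symmetric e by apply: del_edges_sym => //; apply: edge_uv_sym.
have DK x y : edge_uv u v x y -> y \in [set u; v].
  by rewrite edge_uvE !inE => /orP[] /andP[_ ->]; rewrite ?orbT.
apply/setP=> C; rewrite !inE; apply/componentsP/orP=> [[x ->]|[] /eqP->]; last 2 first.
- by exists u.
- by exists v.
have [z] := connect_del_cover conn (set21 u v) DK x.
by rewrite !inE => /orP[] /eqP->; rewrite -cl_eq // eq_sym; [left|right].
Qed.

(** Deleting an edge can lower a count only by an exchange. Inside a larger clique, [chip_structure]
    gives the triangle of b2; an edge that is a whole clique must be a bridge, as in b1. *)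
Lemma classB_intro h F1 F2 u v k : (forall x y, connect h x y) ->
  hamming_decomp h F1 F2 -> h u v ->
  k < maxn (ncomp F1) (ncomp F2) ->
  induced_sub (del_edges h (edge_uv u v)) (@rook k) ->
  exists E1 E2, [/\ hamming_decomp h E1 E2, ncomp E2 < ncomp E1
    & condB1 h E1 E2 u v \/ condB2 h E1 E2 u v].
Proof.
move=> conn; wlog f1 : F1 F2 / F1 u v.
  move=> W D uv; have := uv; rewrite (decompE D) => /orP[f|f]; first exact: W.
  by rewrite maxnC; apply: (W _ _ f (hamming_decompC D)).
move=> DF huv kn emb; have sh := decomp_h_sym DF.
have DF' := hamming_decompC DF.
have uv : u != v := decomp_neq DF huv.
have [H1 [H2 [DH h1 h2]]] := embed_decomp emb.
case: (pickP (fun w => F1 u w && (w != v))) => [w /andP[uwF wv]|none].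
  have [uw vw wN nc] := chip_structure DF DH f1 uwF wv.
  have uw1 := decomp_neq DF uw.
  set D := edges_in h [set u; v; w] in nc.
  have sD : symmetric D by apply: edges_in_sym.
  have DK x y : D x y -> y \in [set u; v; w] by case/and3P.
  have se : symmetric (del_edges h D) by apply: del_edges_sym.
  have iso : cl (del_edges h D) w = [set w].
    apply: cl_isolated => // y; rewrite /del_edges /D /edges_in /=.
    apply/negP=> /andP[wy]; rewrite wy !inE eqxx orbT /=.
    by case: (wN y wy) => ->; rewrite eqxx ?orbT.
  have [G1 [G2 [DG n3 n4 m1 m2]]] := flip_toggle DF conn uw vw uv sD DK nc iso.
  set Cu := cl _ u in n3 n4 m1 m2; set Cv := cl _ v in n3 n4 m1 m2.
  have {}DG : hamming_decomp (del_edges h (edge_uv u v)) G1 G2.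
    by apply: eq_hamming_decomp DG => x y; rewrite -del_toggle.
  have conn' x y : connect (del_edges h (edge_uv u v)) x y.
    have sc : connect_sym (del_edges h (edge_uv u v)).
      by apply/sym_connect_sym/del_edges_sym => //; apply: edge_uv_sym.
    have cw z : (z == u) || (z == v) -> connect (del_edges h (edge_uv u v)) z w.
      move=> zE; apply: connect1; rewrite /del_edges /= edge_uvE.
      rewrite (negPf wv) [w == u]eq_sym (negPf uw1) !andbF andbT.
      by case/orP: zE => /eqP->.
    apply: connect_sub (conn x y) => a b ab.
    case ed: (edge_uv u v a b); last by apply: connect1; rewrite /del_edges /= ab ed.
    move: ed; rewrite edge_uvE => /orP[] /andP[/eqP-> /eqP->];
      (apply: (@connect_trans _ _ w); [|rewrite sc]; apply: cw; rewrite eqxx ?orbT //).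
  have [c3 RE] := three_components_card conn se DK nc iso uw1 (decomp_neq DF vw).
  have [k1 k2] : ncomp G1 <= k /\ ncomp G2 <= k.
    by case: (decomp_unique conn' DH DG) => -[/eq_ncomp-> /eq_ncomp->].
  have [[lt [l1 l2]]|[lt [l1 l2]]] :
      (ncomp F2 < ncomp F1 /\ ncomp_in F2 Cu < ncomp_in F1 Cu /\
         ncomp_in F2 Cv < ncomp_in F1 Cv) \/
      (ncomp F1 < ncomp F2 /\ ncomp_in F1 Cu < ncomp_in F2 Cu /\
         ncomp_in F1 Cv < ncomp_in F2 Cv).
    by move: kn n3 n4 m1 m2 k1 k2; clear; rewrite leq_max /=; lia.
  - by exists F1, F2; split=> //; right; exists w, Cu, Cv, [set w].
  by exists F2, F1; split=> //; right; exists w, Cu, Cv, [set w].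
have uE y : F1 u y -> y = v.
  by move=> uy; apply/eqP; have := none y; rewrite uy /= => /negbFE.
set e := del_edges h (edge_uv u v) in emb DH.
have se : symmetric e by apply: del_edges_sym => //; apply: edge_uv_sym.
(* If [uv] is not a bridge, the decomposition stays unique and has merely gained a component, so it
   cannot fit into side [k]. *)
case c: (connect e u v).
  have conn' x y : connect e x y.
    apply: connect_sub (conn x y) => a b ab.
    case ed: (edge_uv u v a b); last by apply: connect1; rewrite /e /del_edges /= ab ed.
    move: ed; rewrite edge_uvE => /orP[] /andP[/eqP-> /eqP->] //.
    by rewrite sym_connect_sym.
  have [G1 [DG m1 _]] := isolate_edge DF f1 uE.
  have [k1 k2] : ncomp G1 <= k /\ ncomp F2 <= k.
    by case: (decomp_unique conn' DH DG) => -[/eq_ncomp-> /eq_ncomp->].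
  by exfalso; move: kn m1 k1 k2; clear; rewrite leq_max; lia.
have [G1 [G2 [[DG n3 n4 m1 m2] cmp]]] := flip_bridge DF conn huv (negbT c).
(* A decomposition refining [F1] and [F2] would still exceed [k], so the embedding comes from the
   exchanged one. *)
have [k1 k2] : ncomp G1 <= k /\ ncomp G2 <= k.
  by case: (cmp _ _ DH) => -[a b]; move: kn h1 h2 a b; clear; rewrite leq_max; lia.
rewrite f1 (decomp_disj DF f1) -/e in n3 n4 m1 m2.
set Cu := cl e u in n3 n4 m1 m2; set Cv := cl e v in n3 n4 m1 m2.
have RE := bridge_components sh conn huv; rewrite /= -/e -/Cu -/Cv in RE.
have ne : Cu != Cv by rewrite cl_eq // c.
have br : bridge h u v.
  split=> //; rewrite /ncomp RE cards2 ne ltnS.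
  apply: leq_trans (_ : #|[set cl h u]| <= 1); last by rewrite cards1.
  apply: subset_leq_card; apply/subsetP=> C /componentsP[x ->].
  by rewrite inE cl_eq.
(* The bridge contributes one to the old total of [F1] and nothing to that of [F2], while both new
   totals have the extra one: hence the margins 1 and 2. *)
have [[lt [l1 l2]]|[lt [l1 l2]]] :
    (ncomp F2 < ncomp F1 /\ ncomp_in F2 Cu + 1 <= ncomp_in F1 Cu /\
       ncomp_in F2 Cv + 1 <= ncomp_in F1 Cv) \/
    (ncomp F1 < ncomp F2 /\ ncomp_in F1 Cu + 2 <= ncomp_in F2 Cu /\
       ncomp_in F1 Cv + 2 <= ncomp_in F2 Cv).
  by move: kn n3 n4 m1 m2 k1 k2; clear; rewrite leq_max /=; lia.
- exists F1, F2; split=> //; left.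
  by exists 1, Cu, Cv; split=> //; left.
exists F2, F1; split=> //; left.
by exists 2, Cu, Cv; split=> //; right.
Qed.

Lemma classB_elim h F1 F2 u v : connected_graph h ->
  hamming_decomp h F1 F2 -> ncomp F2 < ncomp F1 -> h u v ->
  condB1 h F1 F2 u v \/ condB2 h F1 F2 u v ->
  induced_sub (del_edges h (edge_uv u v)) (@rook (ncomp F1).-1).
Proof.
move=> [T0 conn] DF lt huv; have sh := decomp_h_sym DF.
have n20 := ncomp_gt0 F2 T0; have uv := decomp_neq DF huv.
case=> [[i [A1 [A2 [_ iE [A12 RE] l1 l2]]]]|[w [A1 [A2 [A3 [[uw vw] /= [c3 RE] lt1 lt2 A3E]]]]]].
  set e := del_edges h _ in RE.
  have se : symmetric e by apply: del_edges_sym => //; apply: edge_uv_sym.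
  have RE' := bridge_components sh conn huv; rewrite /= -/e RE in RE'.
  have nc : ~~ connect e u v.
    apply: contra A12; rewrite -cl_eq // => /eqP E.
    have := set21 A1 A2; have := set22 A1 A2; rewrite RE' E setUid !inE.
    by move=> /eqP-> /eqP->.
  have [G1 [G2 [[DG n3 n4 m1 m2] _]]] := flip_bridge DF conn huv nc.
  have iE' : i = F1 u v + (F2 u v).*2.
    by case: iE => -[-> f]; rewrite f ?(decomp_disj DF f) ?(decomp_disj (hamming_decompC DF) f).
  have inA a : cl e a \in [set A1; A2] -> ncomp_in F2 (cl e a) + i <= ncomp_in F1 (cl e a).
    by rewrite !inE => /orP[] /eqP->.
  have l1' := inA u; rewrite RE' set21 in l1'; have {}l1' := l1' isT.
  have l2' := inA v; rewrite RE' set22 in l2'; have {}l2' := l2' isT.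
  have f12 : F2 u v = ~~ F1 u v by apply: decomp_F2 huv.
  rewrite -/e f12 in n3 n4 m1 m2 iE'; apply: (decomp_embed DG); move: n20 lt n3 n4 m1 m2 l1' l2' iE'; clear; case: (F1 u v) => /=; lia.
subst A3; set D := edges_in h _ in c3 RE.
have sD : symmetric D by apply: edges_in_sym.
have DK x y : D x y -> y \in [set u; v; w] by case/and3P.
have se : symmetric (del_edges h D) by apply: del_edges_sym.
have [nc iso l1 l2] :=
  @three_components T h D u v w A1 A2 (fun A => ncomp_in F2 A < ncomp_in F1 A)
    conn se DK c3 RE lt1 lt2.
have [G1 [G2 [DG n3 n4 m1 m2]]] := flip_toggle DF conn uw vw uv sD DK nc iso.
have {}DG : hamming_decomp (del_edges h (edge_uv u v)) G1 G2.
  by apply: eq_hamming_decomp DG => x y; rewrite -del_toggle.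
by apply: (decomp_embed DG); move: n20 lt n3 n4 m1 m2 l1 l2; clear; lia.
Qed.

End UnbalancedClasses.

(** * Chipped graphs *)

Section Chipped.
Variable T : finType.
Implicit Types (h e g F G D : rel T) (A B C K : {set T}) (u v w x y z : T).

Lemma decomp_component h F1 F2 K x y : hamming_decomp h F1 F2 ->
  K \in components F1 -> x \in K -> (y \in K) = (x == y) || F1 x y.
Proof.
move=> D /componentsP[z ->]; rewrite inE => zx.
have /eqP-> : cl F1 z == cl F1 x by rewrite cl_eq //; apply: (decomp_sym D).
exact: (decomp_cl D).
Qed.

Lemma edges_in_component h F1 F2 K : hamming_decomp h F1 F2 ->
  K \in components F1 -> edges_in h K =2 edges_in F1 K.
Proof.
move=> D cK x y; rewrite /edges_in /=.
case xK: (x \in K); rewrite ?andbF //= (decomp_component y D cK xK).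
rewrite (decompE D); case f1: (F1 x y); rewrite ?orbF ?orbT //=.
by case: eqP => [->|]; rewrite ?andbF // (decomp_irr (hamming_decompC D)).
Qed.

Lemma eq_del_edges h D D' : D =2 D' -> del_edges h D =2 del_edges h D'.
Proof. by move=> E x y; rewrite /del_edges /= E. Qed.

Lemma card3_neq (u v w : T) : u != v -> #|[set u; v; w]| = 3 -> w != u /\ w != v.
Proof.
move=> uv; rewrite setUC cardsU1 cards2 uv !inE negb_or.
by case: (w == u); case: (w == v).
Qed.

Lemma card4_neq (u v w x : T) : u != v -> #|[set u; v; w; x]| = 4 ->
  [/\ w != u, w != v, x != u, x != v & x != w].
Proof.
move=> uv; rewrite setUC cardsU1 [[set u; v; w]]setUC cardsU1 cards2 uv !inE !negb_or.
by case: (w == u); case: (w == v); case: (x == u); case: (x == v); case: (x == w).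
Qed.

(** By [chip_structure], [w] would have only the neighbours [u] and [v], against the degree in ch1
    and the vertex [x] in ch3; and [u], [v], [w] would lie in three components, against the two of
    ch2. *)
Lemma chipped_not_hamming h : chipped h -> ~ two_hamming h.
Proof.
move=> [h' [F1 [F2 [K [u [v [[gh [_ conn]] _ D [cK _ [uK vK] [uv hE ch]]]]]]]]].
case/two_hammingP=> G1 [G2 DG].
have {}DG : hamming_decomp (del_edges h' (edge_uv u v)) G1 G2.
  exact: eq_hamming_decomp hE DG.
have uvn := decomp_neq D uv; have sh := gh.1.
have f1 : F1 u v by have := decomp_component v D cK uK; rewrite vK (negPf uvn) /=.
have third w : w \in K -> w != u -> F1 u w.
  by move=> wK wu; have := decomp_component w D cK uK; rewrite wK eq_sym (negPf wu) /=.
have tri w : #|K| = 3 -> K = [set u; v; w] -> F1 u w /\ w != v.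
  move=> c3 KE; rewrite KE in c3; have [wu wv] := card3_neq uvn c3; split=> //.
  by apply: third; rewrite // KE !inE eqxx !orbT.
case: ch => [[w [c3 KE dw]]|[w [c3 KE n2 wC]]|[w [x [c4 KE dw _]]]].
- have [uw wv] := tri w c3 KE; have [_ _ wN _] := chip_structure D DG f1 uw wv.
  have: deg h' w <= #|[set u; v]|.
    by apply: subset_leq_card; apply/subsetP=> y; rewrite !inE => /wN[] ->; rewrite eqxx ?orbT.
  by rewrite cards2 uvn leqNgt dw.
- have [uw wv] := tri w c3 KE; have [huw hvw wN nc] := chip_structure D DG f1 uw wv.
  have eE := eq_del_edges h' (edges_in_component D cK); rewrite KE in eE.
  rewrite KE -(eq_ncomp eE) in n2; move: nc n2; set e := del_edges h' _ => nc n2.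
  have se : symmetric e by apply: del_edges_sym => //; apply: edges_in_sym.
  have DK x y : edges_in h' [set u; v; w] x y -> y \in [set u; v; w] by case/and3P.
  have iso : cl e w = [set w].
    apply: cl_isolated => // y; rewrite /e /del_edges /edges_in /=.
    apply/negP=> /andP[wy]; rewrite wy !inE eqxx orbT /=.
    by case: (wN y wy) => ->; rewrite eqxx ?orbT.
  have [] := three_components_card conn se DK nc iso (decomp_neq D huw) (decomp_neq D hvw).
  by rewrite -/e -/(ncomp e) n2.
rewrite KE in c4; have [wu wv xu xv xw] := card4_neq uvn c4.
have uw : F1 u w by apply: third; rewrite // KE !inE eqxx !orbT.
have [_ _ wN _] := chip_structure D DG f1 uw wv.
have wK : w \in K by rewrite KE !inE eqxx !orbT.
have wx : h' w x.
  apply: (decomp_sub D); have := decomp_component x D cK wK.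
  by rewrite eq_sym (negPf xw) /= => <-; rewrite KE !inE eqxx !orbT.
by case: (wN x wx) => xE; [rewrite xE eqxx in xu|rewrite xE eqxx in xv].
Qed.

Lemma chipped_add h : chipped h ->
  exists u v, [/\ u != v, ~~ h u v & two_hamming (add_edges h (edge_uv u v))].
Proof.
move=> [h' [F1 [F2 [K [u [v [[[sh _] _] _ D [_ _ _ [uv hE _]]]]]]]]].
exists u, v; split; first exact: (decomp_neq D uv).
  by rewrite hE /del_edges /= edge_uv_refl andbF.
apply/two_hammingP; exists F1, F2; apply: eq_hamming_decomp D => x y.
rewrite /add_edges /= hE /del_edges /=; case ed: (edge_uv u v x y).
  rewrite orbT; move: ed; rewrite edge_uvE.
  by case/orP=> /andP[/eqP-> /eqP->]; rewrite ?[h' v u]sh.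
by rewrite andbT orbF.
Qed.

(** The set [C] touches [K] only in [u], and [w] has no [F2]-edges. Exchanging the colours on [C] at
    [w] keeps [uw] and creates no new crossing edge, so exactly the other edges from [u] to [K]
    disappear: [uv] and [ux]. *)
Lemma chip3_del h' F1 F2 K u v : hamming_decomp h' F1 F2 -> K \in components F1 ->
  u \in K -> v \in K -> h' u v -> chip3 h' F1 K u v ->
  exists x, [/\ x \in K, x != u, x != v &
    two_hamming (fun y z => [&& h' y z, ~~ edge_uv u v y z & ~~ edge_uv u x y z])].
Proof.
move=> D cK uK vK uv [w [x [c4 KE dw [C cC KC]]]].
have sh := decomp_h_sym D.
have uvn := decomp_neq D uv; have D' := hamming_decompC D; have sF := decomp_sym D.
have inK a b : a \in K -> b \in K -> a != b -> F1 a b.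
  by move=> aK bK ab; have := decomp_component b D cK aK; rewrite bK (negPf ab) /= => <-.
rewrite KE in c4; have [wu wv xu xv xw] := card4_neq uvn c4.
have wK : w \in K by rewrite KE !inE eqxx !orbT.
have xK : x \in K by rewrite KE !inE eqxx !orbT.
have wN y : h' w y -> y \in K.
  have sub : [set u; v; x] \subset [set y | h' w y].
    apply/subsetP=> z; rewrite !inE => /orP[/orP[]|] /eqP->;
      apply: (decomp_sub D); apply: inK => //; by rewrite eq_sym.
  have /eqP E : [set u; v; x] == [set y | h' w y].
    rewrite eqEcard sub -/(deg h' w) dw setUC cardsU1 cards2 uvn !inE.
    by rewrite (negPf xu) (negPf xv).
  move=> wy; have: y \in [set y | h' w y] by rewrite inE.
  by rewrite -E KE !inE => /orP[/orP[]|] ->; rewrite ?orbT.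
have F2w y : F2 y w = false.
  apply/negP=> f2; rewrite (decomp_sym D') in f2; have wy := decomp_sub D' f2.
  have f1 : F1 w y by apply: inK (wN y wy) (decomp_neq D wy).
  by rewrite (decomp_disj D f1) in f2.
set e := del_edges h' _ in cC.
have se : symmetric e.
  apply: del_edges_sym => // a b; rewrite /edges_in /= sF.
  by congr (_ && _); rewrite andbC.
have uC : u \in C by have := set11 u; rewrite -KC inE => /andP[].
have CE : C = cl e u.
  case/componentsP: cC uC => z -> uz; apply/eqP; rewrite cl_eq //.
  by rewrite inE in uz.
have notC a : a \in K -> a != u -> a \notin C.
  by move=> aK; apply: contra => aC; rewrite -in_set1 -KC inE aK.
have wC := notC w wK wu; have vC : v \notin C by apply: notC; rewrite // eq_sym.
have xC := notC x xK xu.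
have cross y z : y \notin C -> z \in C -> h' y z -> [/\ y \in K, z = u & F1 y z].
  move=> yC zC yz; have : edges_in F1 K y z.
    apply: contraNT yC => nD; move: zC; rewrite CE !inE => zC.
    by apply: connect_trans zC (connect1 _); rewrite se /e /del_edges /= yz.
  case/and3P=> f1 yK zK; split=> //.
  by apply/set1P; rewrite -KC inE zK.
have exit1 y z : y \notin C -> y != w -> z \in C -> F1 y z -> F1 y w.
  by move=> yC yw zC f1; have [yK _ _] := cross y z yC zC (decomp_sub D f1); apply: inK.
have exit2 y z : y \notin C -> y != w -> z \in C -> F2 y z -> F2 y w.
  move=> yC yw zC f2; have [_ _ f1] := cross y z yC zC (decomp_sub D' f2).
  by rewrite (decomp_disj D f1) in f2.
have [G1 [G2 [DG _ _ _ _]]] := flip_decomp D wC exit1 exit2.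
exists x; split=> //; apply/two_hammingP; exists G1, G2.
apply: eq_hamming_decomp DG => y z.
rewrite /flip_adj !F2w !andbF !if_same !edge_uvE.
have crossE a b : a \notin C -> b \in C -> a != w -> h' a b ->
    b = u /\ ((a == v) || (a == x)).
  move=> aC bC aw ab; have [aK bE _] := cross _ _ aC bC ab; split=> //.
  move: aK; rewrite KE !inE (negPf aw) orbF; case/orP=> [/orP[]|->]; rewrite ?orbT //.
    by move/eqP=> aE; rewrite aE uC in aC.
  by move=> ->.
case: ifP => [same|/norP[yz /norP[yw zw]]].
  case hyz: (h' y z) => //=; symmetry; apply/andP; split;
    apply/negP=> /orP[] /andP[/eqP yE /eqP zE]; subst y z; move: same.
  - by rewrite uC (negPf vC) [u == w]eq_sym [v == w]eq_sym (negPf wu) (negPf wv).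
  - by rewrite uC (negPf vC) [u == w]eq_sym [v == w]eq_sym (negPf wu) (negPf wv).
  - by rewrite uC (negPf xC) [u == w]eq_sym (negPf wu) (negPf xw).
  by rewrite uC (negPf xC) [u == w]eq_sym (negPf wu) (negPf xw).
symmetry; apply/negP=> /and3P[hyz n1 n2].
case zC: (z \in C) in yz.
  have yC : y \notin C by apply: contraNN yz => ->.
  have [zE] := crossE y z yC zC yw hyz.
  by case/orP=> yE; [case/negP: n1|case/negP: n2]; rewrite yE zE eqxx ?orbT.
have yC : y \in C by apply: contraNT yz => /negPf->.
rewrite sh in hyz; have [yE] := crossE z y (negbT zC) yC zw hyz.
by case/orP=> zE; [case/negP: n1|case/negP: n2]; rewrite zE yE eqxx.
Qed.

(** For a triangle, deleting [vw] as well takes [v] out of its clique; for four vertices, [ux] is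
    deleted. *)
Lemma chipped_del h : chipped h ->
  exists a b, h a b /\ two_hamming (del_edges h (edge_uv a b)).
Proof.
move=> [h' [F1 [F2 [K [u [v [[[sh _] [_ conn]] _ D [cK _ [uK vK] [uv hE ch]]]]]]]]].
have uvn := decomp_neq D uv; have D' := hamming_decompC D; have sF := decomp_sym D.
have inK x y : x \in K -> y \in K -> x != y -> F1 x y.
  by move=> xK yK xy; have := decomp_component y D cK xK; rewrite yK (negPf xy) /= => <-.
have [[w [c3 KE]]|c3] :
    (exists w, #|K| = 3 /\ K = [set u; v; w]) \/ chip3 h' F1 K u v.
  by case: ch => [[w [c3 KE _]]|[w [c3 KE _ _]]|c]; [left; exists w|left; exists w|right].
- rewrite KE in c3; have [wu wv] := card3_neq uvn c3.
  have wK : w \in K by rewrite KE !inE eqxx !orbT.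
  exists v, w; split.
    rewrite hE /del_edges /= edge_uvE (negPf wu) (negPf wv) !andbF andbT.
    by apply: (decomp_sub D); apply: inK; rewrite // eq_sym.
  apply/two_hammingP; eexists; exists F2.
  apply: eq_hamming_decomp (isolate_decomp v D) => x y.
  rewrite /del_edges /= hE /del_edges /= -andbA; case hxy: (h' x y) => //=.
  rewrite -negb_or; congr (~~ _); rewrite !edge_uvE.
  have vE z : F1 v z = (z == u) || (z == w).
    have := decomp_component z D cK vK; rewrite KE !inE.
    have [->|zv] := eqVneq z v; last by rewrite orbF /= => <-.
    by rewrite (decomp_irr D) [v == u]eq_sym (negPf uvn) [v == w]eq_sym (negPf wv).
  have [->|xv] := eqVneq x v.
    by rewrite vE /= [v == u]eq_sym (negPf uvn) [v == w]eq_sym (negPf wv) andbT /= orbF.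
  rewrite /= !orbF; have [->|yv] := eqVneq y v; last by rewrite !andbF.
  by rewrite sF vE !andbT.
have [x [xK xu xv TH]] := chip3_del D cK uK vK uv c3.
exists u, x; split.
  rewrite hE /del_edges /= edge_uvE eqxx (negPf xv) (negPf xu) /= andbF andbT.
  by apply: (decomp_sub D); apply: inK; rewrite // eq_sym.
case: TH => k k0 emb; exists k => //; apply: eq_induced_sub emb => y z.
by rewrite /del_edges /= hE /del_edges /= andbA.
Qed.

(** The second missing edge is [ux] or [wx]. A claw at [w] excludes neighbours of [w] outside [K].
    Parity separates [u] from [v] and, if [ux] is missing, from [x]; if [wx] is missing, a claw at
    [x] shows that [x] has no outside neighbours either. *)
Lemma chip3_intro h' F1 F2 K g G1 G2 u v w x a : hamming_decomp h' F1 F2 ->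
  hamming_decomp g G1 G2 -> K \in components F1 -> u != v ->
  #|K| = 4 -> K = [set u; v; w; x] ->
  (forall p q, g p q = [&& h' p q, ~~ edge_uv u v p q & ~~ edge_uv a x p q]) ->
  a = u \/ a = w -> chip3 h' F1 K u v.
Proof.
move=> D DG cK uvn c4 KE gE aE; have D' := hamming_decompC D.
have sh := decomp_h_sym D; have sg := decomp_h_sym DG; have sF := decomp_sym D.
have c4' := c4; rewrite KE in c4'; have [wu wv xu xv xw] := card4_neq uvn c4'.
have [uK vK wK xK] : [/\ u \in K, v \in K, w \in K & x \in K].
  by rewrite KE !inE !eqxx !orbT.
have inK p q : p \in K -> q \in K -> p != q -> F1 p q.
  by move=> pK qK pq; have := decomp_component q D cK pK; rewrite qK (negPf pq) /= => <-.
have clK p q : p \in K -> F1 p q -> q \in K.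
  by move=> pK pq; rewrite (decomp_component q D cK pK) pq orbT.
have neqs : [/\ u == w = false, v == w = false, u == x = false, v == x = false & w == x = false].
  by rewrite ![_ == w]eq_sym ![_ == x]eq_sym !(negPf wu, negPf wv, negPf xu, negPf xv, negPf xw).
case: neqs => uw' vw' ux' vx' wx'.
have [uw vw ux vx wx] : [/\ u != w, v != w, u != x, v != x & w != x].
  by rewrite uw' vw' ux' vx' wx'.
have gK p q : p \in K -> q \in K -> p != q -> g p q = ~~ edge_uv u v p q && ~~ edge_uv a x p q.
  by move=> pK qK pq; rewrite gE (decomp_sub D (inK p q pK qK pq)).
have gout p y : p \in K -> y \notin K -> g p y = h' p y.
  move=> pK yK; rewrite gE !edge_uvE.
  have yN b : b \in K -> (y == b) = false by move=> bK; apply: contraNF yK => /eqP->.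
  have aK : a \in K by case: aE => ->.
  by rewrite !yN // !andbF andbT.
(* Edges at [p] into and out of [K] have different colours, so an outside vertex has at most one
   neighbour in [K]. *)
have far p q y : p \in K -> q \in K -> p != q -> y \notin K -> h' p y -> g q y = false.
  move=> pK qK pq yK py; rewrite gout // -(decomp_color D _ py) //.
  - rewrite inK //; apply: contraNF yK; rewrite eq_sym eqb_id; exact: clK.
  - by apply: (decomp_sub D); apply: inK.
  by apply: contraNneq yK => <-.
have vu : v != u by rewrite eq_sym.
have guw : g u w by rewrite gK // !edge_uvE ?uw' // !eqxx !(negPf wu, negPf wv) wx' ux' !andbF.
have gwv : g w v by rewrite gK // !edge_uvE !(negPf wu, negPf wv) wx' vx' /= !andbF.
have guv : g u v = false by rewrite gE edge_uv_refl andbF.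
have wN y : h' w y -> y \in K.
  move=> wy; apply: contraT => yK.
  have gwy : g w y by rewrite gout.
  have gwu : g w u by rewrite sg.
  have gy q : q \in K -> w != q -> g q y = false by move=> qK wq; apply: far wy.
  have neK q : q \in K -> q != y by move=> qK; apply: contraNneq yK => <-.
  exfalso; case: aE => aE; subst a.
    have gux : g u x = false by rewrite gE edge_uv_refl !andbF.
    have gwx : g w x.
      by rewrite gK // !edge_uvE !(negPf wu, negPf wv, negPf xu, negPf xv) wx' /= ?andbF.
    apply: (no_claw DG gwu gwx gwy) => //; rewrite ?ux' ?neK //; exact: gy.
  apply: (no_claw DG gwu gwv gwy) => //; rewrite ?neK //; exact: gy.
have dw : deg h' w = 3.
  have -> : 3 = #|[set u; v; x]|.
    by rewrite setUC cardsU1 cards2 uvn !inE (negPf xu) (negPf xv).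
  apply: eq_card => y; rewrite !inE; apply/idP/idP=> [wy|].
    have := wN y wy; rewrite KE !inE; have yw : y == w = false.
      by rewrite eq_sym; apply: negbTE (decomp_neq D wy).
    by rewrite yw orbF.
  by case/orP=> [/orP[]|] /eqP->; apply: (decomp_sub D); apply: inK; rewrite ?wx'.
set e := del_edges h' (edges_in F1 K).
have se : symmetric e.
  apply: del_edges_sym => // p q; rewrite /edges_in /= sF.
  by congr (_ && _); rewrite andbC.
have eh : subrel e h' by move=> p q /andP[].
have eK p q : p \in K -> e p q -> q \notin K.
  move=> pK /andP[pq]; rewrite /edges_in /= pK /=; apply: contra => qK.
  by rewrite qK inK // (decomp_neq D pq).
have eF p q : p \in K -> e p q -> F1 p q = false.
  by move=> pK pq; apply: contraNF (eK p q pK pq); apply: clK.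
have eg : subrel e g.
  move=> p q pq; case pK: (p \in K); first by rewrite gout ?eh // (eK p).
  case qK: (q \in K); first by rewrite sg gout ?pK // sh eh.
  rewrite gE eh //= !edge_uvE.
  have pN b : b \in K -> (p == b) = false by move=> bK; apply: contraFF pK => /eqP->.
  have aK : a \in K by case: aE => ->.
  by rewrite !pN.
have agree p q r : e p q -> e q r -> p != r -> h' p r = g p r.
  move=> pq qr pr; case pK: (p \in K); last first.
    rewrite gE !edge_uvE.
    have pN b : b \in K -> (p == b) = false by move=> bK; apply: contraFF pK => /eqP->.
    have aK : a \in K by case: aE => ->.
    by rewrite !pN // andbT.
  case rK: (r \in K); last by rewrite gout ?rK.
  have rq : e r q by rewrite se.
  have f2 : F2 p q by rewrite (decomp_F2 D) ?eF ?eh.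
  have f2' : F2 q r by rewrite (decomp_sym D') (decomp_F2 D) ?eF ?eh.
  by have := decomp_trans D' f2 f2' pr; rewrite (decomp_disj D (inK p r pK rK pr)).
(* In [g] the path [u], [w], [z] is induced, so an [e]-walk from [u] to [z] would close through [w]
   with the wrong parity. *)
have odd z : z \in K -> u != z -> g w z -> g u z = false -> ~ connect e u z.
  move=> zK uz gwz guz c.
  have iso p y : p \in K -> e p y -> y != w /\ g w y = false.
    move=> pK py; have yK := eK p y pK py; split; first by apply: contraNneq yK => ->.
    by rewrite gout //; apply: contraNF yK; apply: wN.
  apply: (@no_odd_cycle _ h' F1 F2 g G1 G2 e u z w D DG se eh eg agree) => // y.
  - exact: eF.
  - exact: eF.
  - exact: iso.
  exact: iso.
exists w, x; split=> //; exists (cl e u); first exact: mem_components.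
apply/setP=> z; rewrite in_setI [RHS]in_set1; apply/andP/eqP=> [[zK]|->]; last by rewrite cl_id.
rewrite inE; have [//|zu] := eqVneq z u; move=> c; exfalso.
have eiso b : (forall y, h' b y -> y \in K) -> b \in K -> b != u -> ~ connect e u b.
  move=> bN bK bu ub; have : u \in cl e b by rewrite inE sym_connect_sym.
  rewrite cl_isolated // => [/set1P E|y]; first by rewrite E eqxx in bu.
  by apply/negP=> eby; have := eK b y bK eby; rewrite bN ?eh.
move: zK; rewrite KE !inE (negPf zu) /= => /orP[/orP[]|] /eqP zE; subst z.
- exact: (odd v).
- exact: (eiso w).
case: aE => aE; subst a.
  have gux : g u x = false by rewrite gE edge_uv_refl !andbF.
  have gwx : g w x.
    by rewrite gK // !edge_uvE !(negPf wu, negPf wv, negPf xu, negPf xv) wx' /= ?andbF.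
  by apply: (odd x) => //; rewrite ux'.
apply: (eiso x) => // y xy; apply: contraT => yK.
have gxy : g x y by rewrite gout.
have gxu : g x u by rewrite gK // !edge_uvE !(negPf xu, negPf xv) uw' ux' /= ?andbF.
have gxv : g x v by rewrite gK // !edge_uvE !(negPf xu, negPf xv) vw' vx' /= ?andbF.
have gy q : q \in K -> x != q -> g q y = false by move=> qK xq; apply: far xy.
have neK q : q \in K -> q != y by move=> qK; apply: contraNneq yK => <-.
by exfalso; apply: (no_claw DG gxu gxv gxy) => //; rewrite ?neK //; apply: gy.
Qed.

End Chipped.

(** * Saturation *)

Lemma perm_two_points (n : nat) (a b a' b' : 'I_n) : (a == b) = (a' == b') ->
  exists s : {perm 'I_n}, s a = a' /\ s b = b'.
Proof.
move=> E; pose s1 := tperm a a'.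
exists (s1 * tperm (s1 b) b')%g; rewrite !permM; split; last exact: tpermL.
have s1a : s1 a = a' by apply: tpermL.
rewrite s1a; have [ab|ab] := eqVneq a b.
  by move: E; rewrite -ab eqxx s1a => /esym/eqP<-; apply: tpermL.
apply: tpermD; last by move: E; rewrite (negPf ab) eq_sym => <-.
by rewrite -s1a (inj_eq perm_inj) eq_sym.
Qed.

Section Saturation.
Variable k : nat.
Implicit Types p q a b x y : 'I_k * 'I_k.

(** Rows and columns can be permuted independently; swapping the coordinates carries a pair in a row
    to a pair in a column. *)
Lemma rook_pair_transitive x y x' y' : x != y -> x' != y' -> rook x y = rook x' y' ->
  exists phi : 'I_k * 'I_k -> 'I_k * 'I_k,
    [/\ injective phi, forall p q, rook (phi p) (phi q) = rook p q,
        phi x = x' & phi y = y'].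
Proof.
case: x y x' y' => [x1 x2] [y1 y2] [x1' x2'] [y1' y2'].
rewrite /rook /= !xpair_eqE => n n' E.
have [E1|E1] := eqVneq (x1 == y1) (x1' == y1').
  have E2 : (x2 == y2) = (x2' == y2').
    by move: E; rewrite E1; do 3 case: (_ == _).
  have [s [sx sy]] := perm_two_points E1; have [t [tx ty]] := perm_two_points E2.
  exists (fun p => (s p.1, t p.2)); split; rewrite /= ?sx ?sy ?tx ?ty //.
    by move=> [p1 p2] [q1 q2] /= [/perm_inj-> /perm_inj->].
  by move=> p q; rewrite !(inj_eq perm_inj).
have [E2 E3] : (x1 == y1) = (x2' == y2') /\ (x2 == y2) = (x1' == y1').
  by move: n n' E E1; do 4 case: (_ == _).
have [s [sx sy]] := perm_two_points E2; have [t [tx ty]] := perm_two_points E3.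
exists (fun p => (t p.2, s p.1)); split; rewrite /= ?sx ?sy ?tx ?ty //.
  by move=> [p1 p2] [q1 q2] /= [/perm_inj-> /perm_inj->].
by move=> p q; rewrite !(inj_eq perm_inj) addbC.
Qed.

Variables (T : finType) (h : rel T).
Hypothesis gh : is_graph h.

Lemma move_edge (f : rel ('I_k * 'I_k) -> rel ('I_k * 'I_k) -> rel ('I_k * 'I_k)) x y x' y' :
  (f = @del_edges _ \/ f = @add_edges _) ->
  x != y -> x' != y' -> rook x y = rook x' y' ->
  induced_sub h (f (@rook k) (edge_uv x y)) -> induced_sub h (f (@rook k) (edge_uv x' y')).
Proof.
move=> fE n n' E [j [ji jE]]; have [phi [pi pE px py]] := rook_pair_transitive n n' E.
have eE p q : edge_uv x' y' (phi p) (phi q) = edge_uv x y p q.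
  by rewrite !edge_uvE -px -py !(inj_eq pi).
exists (phi \o j); split; first exact: inj_comp.
by move=> a b /=; rewrite jE; case: fE => ->; rewrite /del_edges /add_edges /= pE eE.
Qed.

Lemma rook_sym : symmetric (@rook k).
Proof. by move=> p q; rewrite /rook /= eq_sym [p.2 == _]eq_sym. Qed.

(** A copy of [h] missing [x] or [y] would already sit in the unmodified graph, so both are images,
    and their preimages are the pair to be joined. *)
Lemma embed_del_rook x y : rook x y -> ~ induced_sub h (@rook k) ->
  induced_sub h (del_edges (@rook k) (edge_uv x y)) ->
  exists u v, [/\ u != v, ~~ h u v & induced_sub (add_edges h (edge_uv u v)) (@rook k)].
Proof.
move=> xy nsub [f [fi fE]].
have xyn : x != y by apply: contraTneq xy => ->; rewrite /rook /= !eqxx.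
case xc: (x \in codom f); last first.
  case: nsub; exists f; split=> // a b; rewrite fE /del_edges /= edge_uv_notin ?andbT //.
  by rewrite xc; left.
case yc: (y \in codom f); last first.
  case: nsub; exists f; split=> // a b; rewrite fE /del_edges /= edge_uv_notin ?andbT //.
  by rewrite yc; right.
have /codomP[u uE] := xc; have /codomP[v vE] := yc; subst x y; exists u, v; split.
- by apply: contraNneq xyn => ->.
- by rewrite fE /del_edges /= edge_uv_refl andbF.
exists f; split=> // a b; rewrite /add_edges /= fE /del_edges /= edge_uv_inj //.
case ed: (edge_uv u v a b); rewrite ?andbF ?andbT ?orbF //=.
move: ed; rewrite edge_uvE => /orP[] /andP[/eqP-> /eqP->]; rewrite ?xy //.
by rewrite rook_sym xy.
Qed.

Lemma embed_add_rook x y : x != y -> ~~ rook x y -> ~ induced_sub h (@rook k) ->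
  induced_sub h (add_edges (@rook k) (edge_uv x y)) ->
  exists u v, h u v /\ induced_sub (del_edges h (edge_uv u v)) (@rook k).
Proof.
move=> xyn xy nsub [f [fi fE]].
case xc: (x \in codom f); last first.
  case: nsub; exists f; split=> // a b; rewrite fE /add_edges /= edge_uv_notin ?orbF //.
  by rewrite xc; left.
case yc: (y \in codom f); last first.
  case: nsub; exists f; split=> // a b; rewrite fE /add_edges /= edge_uv_notin ?orbF //.
  by rewrite yc; right.
have /codomP[u uE] := xc; have /codomP[v vE] := yc; subst x y; exists u, v; split.
  by rewrite fE /add_edges /= edge_uv_refl orbT.
exists f; split=> // a b; rewrite /del_edges /= fE /add_edges /= edge_uv_inj //.
case ed: (edge_uv u v a b); rewrite ?andbF ?andbT ?orbF //=.
symmetry; apply/negP; apply: contraNnot xy => ab.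
by move: ed; rewrite edge_uvE => /orP[] /andP[/eqP aE /eqP bE]; subst a b; rewrite // rook_sym.
Qed.

Lemma saturated_rookP : 2 <= k ->
  induced_saturated h (@rook k) <->
  [/\ ~ induced_sub h (@rook k),
      exists u v, [/\ u != v, ~~ h u v & induced_sub (add_edges h (edge_uv u v)) (@rook k)]
    & exists u v, h u v /\ induced_sub (del_edges h (edge_uv u v)) (@rook k)].
Proof.
move=> k2; split=> [[ns sd sa]|[ns [u [v [uv nuv emb]]] [a [b [ab embd]]]]].
  (* A side of at least two provides an edge and a non-edge to start from. *)
  pose i0 := Ordinal (ltnW k2); pose i1 := Ordinal k2; split=> //.
    apply: (@embed_del_rook (i0, i0) (i0, i1)) => //.
    exact: sd.
  apply: (@embed_add_rook (i0, i0) (i1, i1)) => //.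
  exact: sa.
split=> // x y xy.
  have [f [fi fE]] := emb.
  apply: (move_edge (f := @del_edges _) (x := f u) (y := f v)); first by left.
  - by rewrite (inj_eq fi).
  - by apply: contraTneq xy => ->; rewrite /rook /= !eqxx.
  - by rewrite xy -fE /add_edges /= edge_uv_refl orbT.
  exists f; split=> // p q; rewrite /del_edges /= -fE edge_uv_inj //.
  by rewrite -(del_add gh.1 nuv).
move=> nxy; have [f [fi fE]] := embd.
apply: (move_edge (f := @add_edges _) (x := f a) (y := f b)) => //; first by right.
- by rewrite (inj_eq fi); apply: contraTneq ab => ->; rewrite gh.2.
- by rewrite (negPf nxy) -fE /del_edges /= edge_uv_refl andbF.
exists f; split=> // p q; rewrite /add_edges /= -fE edge_uv_inj // /del_edges /=.
case ed: (edge_uv a b p q); rewrite ?andbT ?orbF //= orbT.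
by move: ed; rewrite edge_uvE => /orP[] /andP[/eqP-> /eqP->]; rewrite // gh.1.
Qed.

End Saturation.

(** * Recognising chipped graphs among the graphs that are not 2-Hamming *)

Section ChippedIntro.
Variable T : finType.
Implicit Types (h g F G : rel T) (u v w x y z : T).

(** Otherwise the induced diamond on these four vertices would survive the deletion of [ab]. *)
Lemma diamond_edge h G1 G2 a b u v p q : is_graph h ->
  hamming_decomp (del_edges h (edge_uv a b)) G1 G2 ->
  h p q -> h p u -> h p v -> h q u -> h q v -> u != v -> h u v = false ->
  a \in [set u; v; p; q] /\ b \in [set u; v; p; q].
Proof.
move=> gh D pq pu pv qu qv uv nuv; apply/andP/contraT; rewrite negb_and => N.
have E x y : x \in [set u; v; p; q] -> y \in [set u; v; p; q] ->
    del_edges h (edge_uv a b) x y = h x y.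
  move=> xK yK; rewrite /del_edges /= edge_uvE.
  suff -> : (x == a) && (y == b) || (x == b) && (y == a) = false by rewrite andbT.
  apply/negP=> /orP[] /andP[/eqP xE /eqP yE]; subst x y; move: N; rewrite ?xK ?yK //.
have [uK vK pK qK] : [/\ u \in [set u; v; p; q], v \in [set u; v; p; q],
    p \in [set u; v; p; q] & q \in [set u; v; p; q]].
  by rewrite !inE !eqxx !orbT.
exfalso; apply: (no_diamond (w := p) (x := q) D _ _ _ _ _ uv); rewrite E //.
Qed.

(** Let [K] be the clique of [uv] in [h + uv]. Any two further vertices of [K] form an induced
    diamond of [h] with [u] and [v], and [ab] must lie in each of these diamonds, which bounds
    [#|K|] by four; [#|K| = 2] would make [h] 2-Hamming. *)
Lemma chipped_intro h u v a b : is_graph h -> connected_graph h -> ~ two_hamming h ->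
  u != v -> ~~ h u v -> two_hamming (add_edges h (edge_uv u v)) ->
  h a b -> two_hamming (del_edges h (edge_uv a b)) -> chipped h.
Proof.
move=> gh [T0 conn] nh uv nuv TH' ab /two_hammingP[G1 [G2 DG]].
have sh := gh.1; set h' := add_edges h _ in TH'.
have huv : h' u v by rewrite /h' /add_edges /= edge_uv_refl orbT.
have [F1 [F2 [D f1]]] : exists F1 F2, hamming_decomp h' F1 F2 /\ F1 u v.
  have [F1 [F2 D]] := (two_hammingP h').1 TH'.
  have := huv; rewrite (decompE D) => /orP[f|f]; first by exists F1, F2.
  by exists F2, F1; split=> //; apply: hamming_decompC.
have D' := hamming_decompC D.
have sh' := decomp_h_sym D.
have gh' : is_graph h' by split=> //; apply: decomp_h_irr D.
have conn' x y : connect h' x y.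
  apply: connect_sub (conn x y) => p q pq; apply: connect1.
  by rewrite /h' /add_edges /= pq.
have delE : del_edges h' (edge_uv u v) =2 h by apply: del_add.
have nh' : ~ two_hamming (del_edges h' (edge_uv u v)).
  by case=> k k0 emb; apply: nh; exists k => //; apply: eq_induced_sub emb.
have hE x y : h x y = h' x y && ~~ edge_uv u v x y by rewrite -delE.
pose K := cl F1 u; have cK : K \in components F1 by apply: mem_components.
have inK y : (y \in K) = (u == y) || F1 u y by apply: (decomp_cl D).
have uK : u \in K by rewrite inK eqxx.
have vK : v \in K by rewrite inK f1 orbT.
have chip : #|K| = 3 \/ #|K| = 4 ->
    [\/ chip1 h' K u v, chip2 h' F1 K u v | chip3 h' F1 K u v] -> chipped h.
  move=> cK34 ch; exists h', F1, F2, K, u, v; split=> //; split=> //; split=> //.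
case: (pickP (fun w => F1 u w && (w != v))) => [w /andP[uw wv]|none]; last first.
  have uE y : F1 u y -> y = v.
    by move=> uy; apply/eqP; have := none y; rewrite uy /= => /negbFE.
  have [G [DI _ _]] := isolate_edge D f1 uE.
  by case: nh'; apply/two_hammingP; exists G, F2.
have wu : w != u by rewrite eq_sym; apply: decomp_neq D (decomp_sub D uw).
have F1K x y : x \in K -> y \in K -> x != y -> F1 x y.
  by move=> xK yK xy; have := decomp_component y D cK xK; rewrite yK (negPf xy) /= => <-.
have wK : w \in K by rewrite inK uw orbT.
case: (pickP (fun x => [&& F1 u x, x != v & x != w])) => [x /and3P[ux xv xw]|none]; last first.
  have KE : K = [set u; v; w].
    apply/setP=> y; rewrite inK !inE [u == y]eq_sym; have [//|yu] := eqVneq y u.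
    rewrite /=; apply/idP/orP=> [uy|[] /eqP->] //.
    by have := none y; rewrite uy /=; case: eqP => [|_ /negbFE]; [left|right].
  have c3 : #|K| = 3.
    by rewrite KE setUC cardsU1 cards2 uv !inE (negPf wu) (negPf wv).
  apply: (chip (or_introl c3)).
  have huw : h' u w := decomp_sub D uw.
  have hvw : h' v w by apply: (decomp_sub D); apply: F1K; rewrite // eq_sym.
  case: (pickP (fun y => F2 w y)) => [y wy|iso].
    apply: Or31; exists w; split=> //.
    have yK : y \notin K.
      apply/negP=> yK; have wyn := decomp_neq D' (decomp_sub D' wy).
      by rewrite (decomp_disj D (F1K w y wK yK wyn)) in wy.
    have <- : #|[set u; v; y]| = 3.
      rewrite setUC cardsU1 cards2 uv !inE.
      have -> : (y == u) = false by apply: contraNF yK => /eqP->.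
      by have -> : (y == v) = false by apply: contraNF yK => /eqP->.
    apply: subset_leq_card; apply/subsetP=> z; rewrite !inE.
    case/orP=> [/orP[]|] /eqP->; [by rewrite sh'|by rewrite sh'|].
    exact: (decomp_sub D' wy).
  set e := del_edges h' (edges_in h' [set u; v; w]).
  have DK x y : edges_in h' [set u; v; w] x y -> y \in [set u; v; w] by case/and3P.
  have sE : symmetric (edges_in h' [set u; v; w]) by apply: edges_in_sym.
  have se : symmetric e by apply: del_edges_sym.
  have wiso : cl e w = [set w].
    apply: cl_isolated => // y; apply/negP=> /andP[wy].
    rewrite /edges_in /= -KE wK wy /=.
    move: wy; rewrite (decompE D) iso orbF => wy.
    by rewrite (decomp_component y D cK wK) wy orbT.
  have eE : e =2 del_edges h' (edges_in F1 K).
    by rewrite /e -KE; apply: eq_del_edges; apply: edges_in_component D cK.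
  (* If the triangle separated [u] from [v], the exchange at [w] would remove [uv] and make [h]
     2-Hamming. *)
  case c: (connect e u v); last first.
    have [H1 [H2 [DH _ _ _ _]]] := flip_toggle D conn' huw hvw uv sE DK (negbT c) wiso.
    case: nh'; apply/two_hammingP; exists H1, H2.
    by apply: eq_hamming_decomp DH => p q; rewrite del_toggle.
  apply: Or32; exists w; split=> //; last by rewrite -(eq_components eE) -wiso mem_components.
  rewrite -(eq_ncomp eE) /ncomp (components_del3 conn' se DK) -/e.
  have /eqP-> : cl e u == cl e v by rewrite cl_eq.
  rewrite setUid cards2; suff -> : cl e v != cl e w by [].
  rewrite wiso; apply: contraNneq wv => E; rewrite eq_sym -in_set1 -E.
  exact: cl_id.
have xu : x != u by rewrite eq_sym; apply: decomp_neq D (decomp_sub D ux).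
have xK : x \in K by rewrite inK ux orbT.
have hK p q : p \in K -> q \in K -> p != q -> ~~ edge_uv u v p q -> h p q.
  by move=> pK qK pq ne; rewrite hE ne (decomp_sub D (F1K p q pK qK pq)).
have third p q : p \in K -> q \in K -> p != u -> p != v -> p != q -> h p q.
  by move=> pK qK pu pv pq; apply: hK => //; rewrite edge_uvE (negPf pu) (negPf pv).
have dia p q : p \in K -> q \in K -> p != u -> p != v -> q != u -> q != v -> p != q ->
    a \in [set u; v; p; q] /\ b \in [set u; v; p; q].
  move=> pK qK pu pv qu qv pq; apply: (diamond_edge gh DG) => //; try exact: third.
  exact: negbTE.
have abn : a != b by apply: contraTneq ab => ->; rewrite gh.2.
case: (pickP (fun y => [&& F1 u y, y != v, y != w & y != x])) => [y /and4P[uy yv yw yx]|none].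
  have yu : y != u by rewrite eq_sym; apply: decomp_neq D (decomp_sub D uy).
  have yK : y \in K by rewrite inK uy orbT.
  have neqs : [/\ w != x, w != y & x != y] by rewrite [w == x]eq_sym ![_ == y]eq_sym.
  case: neqs => wx wy xy.
  (* With five vertices in [K], the three diamonds share only [u] and [v], which are not adjacent in
     [h]. *)
  have [a1 b1] := dia w x wK xK wu wv xu xv wx.
  have [a2 b2] := dia w y wK yK wu wv yu yv wy.
  have [a3 b3] := dia x y xK yK xu xv yu yv xy.
  have inuv c : c \in [set u; v; w; x] -> c \in [set u; v; w; y] ->
      c \in [set u; v; x; y] -> c = u \/ c = v.
    rewrite !inE; have [->|_] := eqVneq c u; first by left.
    have [->|_] := eqVneq c v; first by right.
    have [->|_] := eqVneq c w; first by rewrite (negPf wx) (negPf wy).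
    by have [->|_] := eqVneq c x; first by rewrite (negPf xy).
  case: (inuv a a1 a2 a3) => aE; case: (inuv b b1 b2 b3) => bE; subst a b;
    move: ab abn; rewrite ?eqxx // ?[h v u]sh (negPf nuv) //.
have KE : K = [set u; v; w; x].
  apply/setP=> y; rewrite inK !inE [u == y]eq_sym; have [//|yu] := eqVneq y u.
  rewrite /=; apply/idP/idP=> [uy|/orP[/orP[]|] /eqP->] //.
  by have := none y; rewrite uy /=; case: (y == v); case: (y == w); case: (y == x).
have wx : w != x by rewrite eq_sym.
have c4 : #|K| = 4.
  rewrite KE setUC cardsU1 [[set u; v; w]]setUC cardsU1 cards2 uv !inE.
  by rewrite (negPf wu) (negPf wv) (negPf xu) (negPf xv) (negPf xw).
have vu : v != u by rewrite eq_sym.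
have edgeE u1 v1 : edge_uv u1 v1 =2 edge_uv u v -> forall w1 x1 a1,
    K = [set u1; v1; w1; x1] -> u1 != v1 -> a1 = u1 \/ a1 = w1 ->
    edge_uv a1 x1 =2 edge_uv a b -> chip3 h' F1 K u1 v1.
  move=> E1 w1 x1 a1 KE1 uv1 aE E2; apply: (chip3_intro D DG cK uv1 c4 KE1 _ aE) => p q.
  by rewrite E1 E2 /del_edges /= hE andbA.
have C1 := edgeE u v (fun _ _ => erefl); have C2 := edgeE v u (edge_uvC v u).
have K1 : K = [set u; v; x; w] by rewrite KE -setUA [[set w] :|: _]setUC setUA.
have K2 : K = [set v; u; w; x] by rewrite KE [[set u; v]]setUC.
have K3 : K = [set v; u; x; w] by rewrite K1 [[set u; v]]setUC.
have chip' : chip3 h' F1 K v u -> chipped h.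
  move=> ch; exists h', F1, F2, K, v, u; split=> //; split=> //; first by right.
  split=> //; first by rewrite sh'.
    by move=> p q; rewrite hE /del_edges /= edge_uvC.
  exact: Or33.
have chip3' : chip3 h' F1 K u v -> chipped h.
  by move=> ch; apply: chip; [right|apply: Or33].
have edgeC p q : edge_uv p q =2 edge_uv q p by apply: edge_uvC.
(* So [ab] is an edge inside [K] other than [uv]. Interchanging [u] with [v] and [w] with [x] brings
   it to the form [ux] or [wx]. *)
have [] := dia w x wK xK wu wv xu xv wx; rewrite !inE.
case/orP=> [/orP[/orP[]|]|] /eqP aE; case/orP=> [/orP[/orP[]|]|] /eqP bE;
  subst a b; first [by rewrite eqxx in abn | by rewrite ?[h v u]sh (negPf nuv) in ab | idtac].
- by apply: chip3'; apply: (C1 x w u K1 uv (or_introl erefl)).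
- by apply: chip3'; apply: (C1 w x u KE uv (or_introl erefl)).
- by apply: chip'; apply: (C2 x w v K3 vu (or_introl erefl)).
- by apply: chip'; apply: (C2 w x v K2 vu (or_introl erefl)).
- by apply: chip3'; apply: (C1 x w u K1 uv (or_introl erefl)).
- by apply: chip'; apply: (C2 x w v K3 vu (or_introl erefl)).
- by apply: chip3'; apply: (C1 w x w KE uv (or_intror erefl)).
- by apply: chip3'; apply: (C1 w x u KE uv (or_introl erefl)).
- by apply: chip'; apply: (C2 w x v K2 vu (or_introl erefl)).
by apply: chip3'; apply: (C1 w x w KE uv (or_intror erefl)).
Qed.

End ChippedIntro.

(* [K_1 [] K_1] has neither edges nor non-edges, so it is vacuously
   [H]-induced-saturated for every [H] with at least two vertices; [k] therefore
   ranges over the nondegenerate values [2 <= k]. *)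
Theorem theorem12 (T : finType) (h : rel T) (Hgraph : is_graph h)
  (Hconn : connected_graph h) :
  (exists2 k : nat, 2 <= k & induced_saturated h (@rook k)) <->
  (chipped h \/ (classA h /\ classB h)).
Proof.
have [T0 conn] := Hconn; split=> [[k k2 /(saturated_rookP Hgraph k2)]|].
  case=> ns [u [v [uv nuv emb]]] [a [b [ab embd]]]; have k1 : 0 < k := ltnW k2.
  case: (two_hamming_dec h) => [TH|nTH]; [right|left]; last first.
    by apply: (chipped_intro Hgraph Hconn nTH uv nuv _ ab); exists k.
  have [F1 [F2 D]] := (two_hammingP h).1 TH.
  have kn : k < maxn (ncomp F1) (ncomp F2).
    rewrite ltnNge geq_max; apply/negP=> /andP[n1 n2]; apply: ns.
    exact: (decomp_embed D).
  have cls E1 E2 : hamming_decomp h E1 E2 -> ncomp E2 < ncomp E1 ->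
      ~ balanced h /\ optimal_decomp h E1 E2.
    move=> DE lt; split; last exact: connected_optimal.
    by apply: (connected_unbalanced Hconn DE); rewrite neq_ltn lt orbT.
  split.
    have [E1 [E2 [DE lt cond]]] := classA_intro conn D uv nuv kn emb.
    have [nb opt] := cls _ _ DE lt; split=> //; exists E1, E2; split=> //.
    by exists u, v.
  have [E1 [E2 [DE lt cond]]] := classB_intro conn D ab kn embd.
  have [nb opt] := cls _ _ DE lt; split=> //; exists E1, E2; split=> //.
  by exists a, b.
(* A side that admits every 2-Hamming graph on [T] and is at least two. *)
have big (g : rel T) : two_hamming g -> induced_sub g (@rook #|T|.+2).
  case/two_hammingP=> F1 [F2 D].
  by apply: (decomp_embed D) => //; rewrite !leqW ?ncomp_le_card.
case=> [ch|[[_ _ _ [F1 [F2 [[D _] lt [u [v [uv nuv cA]]]]]]] [_ _ _ [E1 [E2 [[DE _] ltE [a [b [ab cB]]]]]]]]].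
  exists #|T|.+2 => //; apply/saturated_rookP=> //; split.
  - by move=> emb; apply: (chipped_not_hamming ch); exists #|T|.+2.
  - by have [u [v [uv nuv TH]]] := chipped_add ch; exists u, v; split=> //; apply: big.
  by have [a [b [ab TH]]] := chipped_del ch; exists a, b; split=> //; apply: big.
have embA := classA_elim Hconn D lt uv nuv cA.
have embB := classB_elim Hconn DE ltE ab cB.
(* The two classes come with separate decompositions; by uniqueness they agree up to order, and the
   larger colour fixes the order. *)
have nE : ncomp E1 = ncomp F1.
  case: (decomp_unique conn D DE) => -[/eq_ncomp e1 /eq_ncomp e2] //.
  by move: lt ltE e1 e2; clear; lia.
rewrite nE in embB; set k := (ncomp F1).-1 in embA embB.
have n2 := ncomp_gt0 F2 T0.
have k0 : 0 < k by rewrite /k; move: n2 lt; clear; lia.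
(* A grid of side one has a single vertex and cannot contain the distinct [u] and [v]. *)
have k2 : 2 <= k.
  rewrite ltn_neqAle k0 andbT; apply/eqP=> k1; case: embA => f [fi _].
  case/eqP: uv; apply: fi; rewrite -k1 in f *.
  by case: (f u) (f v) => [p q] [p' q']; rewrite !ord1.
exists k => //; apply/saturated_rookP=> //; split.
- case/(connected_embed conn D k0) => n1 _.
  by move: n1 k0; rewrite /k; clear; lia.
- by exists u, v.
by exists a, b.
Qed.
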